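(* Let $T$ be an infinite, locally finite tree rooted at $o$, with no leaves except possibly $o$, with interaction strengths $\{J_v: v\ne o\}$ satisfying $0<J_{\min}\le J_v\le J_{\max}<\infty$ for all $v\ne o$, and let $\beta>0$. Assign to the edge between $v$ and its parent the resistance $$R_v=\prod_{o<y\le v}(\tanh(\beta J_y))^{-2}.$$ Then, as $N\to\infty$, the conditional probabilities $\mathbf P^{(N,\mathrm{sg})}\big(\eta(o)=1\,\big|\,\eta|_{\partial T^{(N)}}\big)$ converge in law to the constant $1/2$ under the spin-glass measures $\mathbf P^{(N,\mathrm{sg})}$ if and only if $\mathrm{cap}_2(T)=0$.
   Context: For vertices, $y\le w$ means $y$ lies on the path from the root $o$ to $w$; $y<w$ means $y\le w$, $y\neq w$. $v\to w$ means $v$ is the parent of $w$ (the neighbor of $w$ closer to $o$). $|v|$ is the distance from $o$ to $v$. The interaction $J_w$ is attached to the edge from $w$ to its parent. Spin-glass measure: $T^{(N)}$ is the subtree induced on $\{v:|v|\le N\}$ and $\partial T^{(N)}=\{v:|v|=N\}$. With $W(\eta)=\prod_{v\to w}\exp(\beta J_w\eta(v)\eta(w))$ (product over edges of $T^{(N)}$), the measure $\mathbf P^{(N,\mathrm{sg})}$ on $\{\pm1\}^{V(T^{(N)})}$ is $$\mathbf P^{(N,\mathrm{sg})}(\eta)=2^{-|\partial T^{(N)}|}\frac{W(\eta)}{\sum_{\xi:\,\xi|_{\partial T^{(N)}}=\eta|_{\partial T^{(N)}}}W(\xi)},$$ i.e. the boundary spins are i.i.d. fair signs, and given them the configuration has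 probability proportional to $W$. Capacity: $\partial T$ is the set of maximal (here infinite) paths from $o$ directed away from the root. A flow $\mu$ is a nonnegative function on edges with $\mu(vw)=\sum_{y:w\to y}\mu(wy)$ whenever $v\to w$ and $w$ is not a leaf; $|\mu|=\sum_{y:o\to y}\mu(oy)$. For $p>1$, $s=p-1$ and resistances $R(e)$, set $V_\mu(y)=\sum_{e\in y}(\mu(e)R(e))^s$ for $y\in\partial T$, $V(\mu)=\sup_{y\in\partial T}V_\mu(y)$, and $\mathrm{cap}_p(T)=\sup\{|\mu| : \mu \text{ a flow on } T \text{ with } V(\mu)=1\}$ (equal to $0$ if there is no such flow). *)

(* Defs.v *)
From HB Require Import structures.
From mathcomp Require Import all_boot all_order all_algebra finmap.
From mathcomp Require Import all_classical all_reals all_analysis.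

Set Implicit Arguments.
Unset Strict Implicit.
Unset Printing Implicit Defensive.

Import Order.TTheory GRing.Theory Num.Theory.
Import numFieldNormedType.Exports.

Local Open Scope classical_set_scope.
Local Open Scope ring_scope.

(* A locally finite rooted tree is encoded by its parent map. The value of
   [parent] at the root is a convention; it is not an edge of the tree. *)
Record rootedTree := RootedTree {
  vertex :> choiceType;
  origin : vertex;
  parent : vertex -> vertex;
  parent_origin : parent origin = origin;
  to_origin : forall v, exists n, iter n parent v == origin;
  locally_finite :
    forall v, finite_set [set w | w <> origin /\ parent w = v]
}.
Arguments origin : clear implicits.
Arguments parent {T} v : rename.

Section Trees.
Variable T : rootedTree.
Implicit Types (v w y : T) (n N : nat).

Definition edge v w : Prop := w <> origin T /\ parent w = v.

Definition tle y w : Prop := exists n, iter n parent w = y.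

Definition tlt y w : Prop := tle y w /\ y <> w.

Definition depth v : nat := ex_minn (to_origin v).

Definition leaf v : Prop := exists! w, edge v w \/ edge w v.

Definition children v : {fset T} := fset_set (edge v).

Definition trunc N : {fset T} := fset_set [set v | (depth v <= N)%N].

Definition bdry N : {fset T} := fset_set [set v | depth v = N].

(* Infinite paths from the root directed away from it. In a tree without
   leaves other than the root these are all the maximal paths. *)
Definition ray (y : nat -> T) : Prop :=
  y 0%N = origin T /\ forall n, edge (y n) (y n.+1).

Lemma depth_origin : depth (origin T) = 0%N.
Proof.
rewrite /depth; case: ex_minnP => m _ /(_ 0%N) /=.
by rewrite eqxx leqn0 => /(_ isT)/eqP.
Qed.

Lemma depth_edge v w : edge v w -> depth w = (depth v).+1.
Proof.
move=> [wr pw]; rewrite /depth.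
case: ex_minnP => m rm minm; case: ex_minnP => k rk mink.
case: m rm minm => [/eqP /wr//|m].
rewrite iterSr pw => rm minm; apply/eqP; rewrite eqSS eqn_leq mink// andbT.
by rewrite -ltnS minm// iterSr pw.
Qed.

Lemma depth_eq0 v : depth v = 0%N -> v = origin T.
Proof. by rewrite /depth; case: ex_minnP => m /eqP + _ m0; rewrite m0. Qed.

Lemma finite_bdry N : finite_set [set v : T | depth v = N].
Proof.
elim: N => [|N IH].
  apply: (sub_finite_set _ (finite_set1 (origin T))) => v /= /depth_eq0 //.
apply: (sub_finite_set _ (bigcup_finite IH (fun v _ => @locally_finite T v))).
move=> w /= dw; have wr : w <> origin T.
  by move=> wr; rewrite wr depth_origin in dw.
exists (parent w) => //=; apply/eqP; rewrite -eqSS -dw.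
by rewrite -(@depth_edge (parent w) w).
Qed.

Lemma finite_trunc N : finite_set [set v : T | (depth v <= N)%N].
Proof.
apply: (sub_finite_set _ (bigcup_finite (finite_II N.+1)
  (fun n _ => finite_bdry n))).
by move=> v /= dv; exists (depth v).
Qed.

Lemma in_trunc N v : (v \in trunc N) = (depth v <= N)%N.
Proof.
by rewrite in_fset_set ?inE; [apply/idP/idP; rewrite inE | exact: finite_trunc].
Qed.

Lemma in_bdry N v : (v \in bdry N) = (depth v == N).
Proof.
rewrite in_fset_set; last exact: finite_bdry.
by apply/idP/idP; rewrite inE => /eqP.
Qed.

Lemma origin_trunc N : origin T \in trunc N.
Proof. by rewrite in_trunc depth_origin. Qed.

Definition trunc_origin N : trunc N := [` origin_trunc N]%fset.

End Trees.
Arguments trunc : clear implicits.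
Arguments bdry : clear implicits.
Arguments trunc_origin : clear implicits.

Section SpinGlass.
Variables (R : realType) (T : rootedTree) (J : T -> R) (beta : R).

(* Spin +1 is [true] and spin -1 is [false]. *)
Definition spin (b : bool) : R := if b then 1 else -1.

Definition config (N : nat) : finType := {ffun trunc T N -> bool}.

(* J is indexed by the lower endpoint of an edge. *)
Definition weight N (eta : config N) : R :=
  \prod_(e : trunc T N * trunc T N | `[< edge (val e.1) (val e.2) >])
    expR (beta * J (val e.2) * spin (eta e.1) * spin (eta e.2)).

Definition same_boundary N (xi eta : config N) : bool :=
  [forall v : trunc T N, (val v \in bdry T N) ==> (xi v == eta v)].

(* The boundary spins are i.i.d. fair signs and, given them, the configuration
   has probability proportional to its weight. *)
Definition sg_prob N (eta : config N) : R :=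
  2 ^- #|` bdry T N| *
  (weight eta / \sum_(xi : config N | same_boundary xi eta) weight xi).

(* The conditional probability that the root has spin +1 given the boundary
   spins, as a random variable on configurations. *)
Definition sg_origin_cond N (eta : config N) : R :=
  (\sum_(xi : config N | same_boundary xi eta && xi (trunc_origin T N))
     sg_prob xi) /
  (\sum_(xi : config N | same_boundary xi eta) sg_prob xi).

End SpinGlass.

(* Convergence in law to the constant c of random variables X N, each defined
   on its own finite probability space with mass function P N. *)
Definition cvg_in_law_cst (R : realType) (Omega : nat -> finType)
    (P : forall N, Omega N -> R) (X : forall N, Omega N -> R) (c : R) : Prop :=
  forall f : R -> R, continuous f -> bounded_fun f ->
    (fun N => \sum_(w : Omega N) P N w * f (X N w)) @ \oo --> f c.

Definition tanh (R : realType) (x : R) : R :=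
  (expR x - expR (- x)) / (expR x + expR (- x)).

Section Capacity.
Variables (R : realType) (T : rootedTree).
Local Open Scope ereal_scope.

(* Edge functions (flows and resistances) are indexed by the lower endpoint of
   the edge; their values at the root play no role. *)

Definition is_flow (mu : T -> R) : Prop :=
  (forall w, w <> origin T -> (0 <= mu w)%R) /\
  (forall v w, edge v w -> ~ leaf w -> mu w = (\sum_(y <- children w) mu y)%R).

Definition flow_strength (mu : T -> R) : R :=
  (\sum_(y <- children (origin T)) mu y)%R.

Definition ray_potential (p : R) (Res mu : T -> R) (y : nat -> T) : \bar R :=
  \sum_(0 <= n <oo) (((mu (y n.+1) * Res (y n.+1)) `^ (p - 1))%R)%:E.

Definition flow_potential (p : R) (Res mu : T -> R) : \bar R :=
  ereal_sup [set ray_potential p Res mu y | y in @ray T].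

Definition capacity (p : R) (Res : T -> R) : \bar R :=
  let A := [set (flow_strength mu)%:E | mu in
             [set mu | is_flow mu /\ flow_potential p Res mu = 1]] in
  if `[< A !=set0 >] then ereal_sup A else 0.

End Capacity.

Definition tanh_resistance (R : realType) (T : rootedTree) (J : T -> R)
    (beta : R) (v : T) : R :=
  \prod_(y <- fset_set [set y | tlt (origin T) y /\ tle y v])
    (tanh (beta * J y)) ^- 2.

(* Main.v *)
(** Given the boundary spins, the log-likelihood ratio X_v of the spin at v
    satisfies X_v = sum over children w of f_w(X_w), where
    f_w(x) = 2 artanh(tanh(beta J_w) tanh(x / 2)). The boundary spins being
    i.i.d. fair signs, the summands are independent and symmetric, so
    s_v := E X_v^2 is additive over the children. With t_w := tanh(beta J_w),
    t_w^2 x^2 / (1 + x^2 / 4) <= f_w(x)^2 <= t_w^2 x^2 / (1 + c x^2).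
    Jensen's inequality turns the upper bound into
    E f_w(X_w)^2 <= t_w^2 s_w / (1 + c s_w). For the lower bound one needs
    E X^4 <= 3 (E X^2)^2, which is stable under independent symmetric sums and
    under f_w, because f_w is increasing and f_w(x) / x is decreasing for x > 0.
    Hence u_v := s_v / R_v satisfies, up to the constant, the series-parallel
    recursion u_v ~ sum of 1 / (1 / u_w + c R_w), and s_o stays bounded below
    exactly when there is a nonzero flow of bounded potential: such a flow
    propagates a lower bound on u from the boundary to the root, and
    conversely splitting a unit mass in proportion to E f_w(X_w)^2 gives flows
    on the truncated trees with potential at most 1 / (c s_o), whose limit along
    an ultrafilter is a flow on T. *)

Require Import Defs.
From mathcomp Require Import all_boot all_order all_algebra finmap.
From mathcomp Require Import all_classical all_reals all_analysis.
From mathcomp Require Import ring lra.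

Set Implicit Arguments.
Unset Strict Implicit.
Unset Printing Implicit Defensive.

Import Order.TTheory GRing.Theory Num.Theory.
Import numFieldNormedType.Exports.

Local Open Scope classical_set_scope.
Local Open Scope ring_scope.

(** * The map f_w *)

(** Mean value theorem, in the form behind every one-variable inequality below: a difference of two
    sides is written as [F], and only the sign of its derivative on the segment is checked. *)
Lemma le_is_derive (R : realType) (F dF : R -> R) (a b : R) :
  a <= b -> (forall x, a <= x <= b -> is_derive x 1 F (dF x)) ->
  (forall x, a <= x <= b -> 0 <= dF x) -> F a <= F b.
Proof.
move=> ab dFE dF0.
have [] := @MVT_segment R F dF a b ab.
- move=> x; rewrite in_itv/= => /andP[/ltW ax /ltW xb].
  by apply: dFE; rewrite ax xb.
- apply: derivable_within_continuous => x; rewrite in_itv/= => xab.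
  exact: (@ex_derive _ _ _ _ _ _ _ (dFE x xab)).
- move=> c; rewrite in_itv/= => cab e.
  by rewrite -subr_ge0 e mulr_ge0 ?dF0 ?subr_ge0.
Qed.

Section EdgeMap.
Variable R : realType.
Implicit Types b x y : R.

(** The excess of the right-hand side over 2 is the square of [expR (x / 2) - expR (- (x / 2))],
    which is at least [x] when [x >= 0]. *)
Lemma expRD_expRN_ge x : 2 + x ^+ 2 <= expR x + expR (- x).
Proof.
wlog x0 : x / 0 <= x => [H|].
  have [/H//|/ltW] := leP 0 x; rewrite -oppr_ge0 => /H.
  by rewrite sqrrN opprK [expR (- x) + _]addrC.
have sinh_ge : x <= expR (x / 2) - expR (- (x / 2)).
  set y := x / 2; have -> : x = 2 * y by rewrite /y; field.
  rewrite -subr_ge0.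
  pose F z : R := expR z - expR (- z) - 2 * z.
  have -> : expR y - expR (- y) - 2 * y = F y by [].
  have -> : 0 = F 0 by rewrite /F oppr0 subrr mulr0 subr0.
  apply: (@le_is_derive R F (fun z => expR z + expR (- z) - 2)).
  - by rewrite /y divr_ge0.
  - move=> z _; have -> : F = (expR - (expR \o -%R)) - (2 *: id).
      by apply/funext.
    apply: is_derive_eq; rewrite /GRing.scale /=. lra.
  - move=> z _.
    have := sqr_ge0 (expR (z / 2) - expR (- (z / 2))).
    rewrite sqrrB -!expRM_natl -expRD subrr expR0.
    have -> : 2%:R * (z / 2) = z by field.
    have -> : 2%:R * - (z / 2) = - z by field.
    lra.
have : x ^+ 2 <= (expR (x / 2) - expR (- (x / 2))) ^+ 2 by rewrite ler_sqr ?nnegrE ?(le_trans x0).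
rewrite sqrrB -!expRM_natl -expRD subrr expR0.
have -> : 2%:R * (x / 2) = x by field.
have -> : 2%:R * - (x / 2) = - x by field.
lra.
Qed.

(** This is 2 artanh(tanh b tanh(x/2)): the argument of [ln] is the likelihood ratio at one end of
    an edge of strength [b] when the ratio at the other end is [expR x]. *)
Definition edge_map b x : R :=
  ln ((expR b * expR x + expR (- b)) / (expR (- b) * expR x + expR b)).


Lemma edge_map_num_gt0 b x : 0 < expR b * expR x + expR (- b).
Proof. by rewrite addr_gt0 ?mulr_gt0 ?expR_gt0. Qed.

Lemma edge_mapE b x : edge_map b x =
  ln (expR b * expR x + expR (- b)) - ln (expR (- b) * expR x + expR b).
Proof.
rewrite /edge_map ln_div ?posrE ?edge_map_num_gt0//.
by have := edge_map_num_gt0 (- b) x; rewrite opprK.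
Qed.

Lemma edge_mapN b x : edge_map b (- x) = - edge_map b x.
Proof.
have e0 := expR_gt0 x.
have h1 := edge_map_num_gt0 b x; have h2 := edge_map_num_gt0 (- b) x.
rewrite /edge_map; rewrite opprK in h2.
rewrite -lnV ?posrE ?divr_gt0// invf_div; congr (ln _).
rewrite [expR (- x)]expRN; field.
rewrite !gt_eqF//; nra.
Qed.

Lemma edge_map0 b : edge_map b 0 = 0.
Proof.
rewrite /edge_map expR0 !mulr1 [X in _ / X]addrC divff ?ln1//.
by rewrite gt_eqF// addr_gt0 ?expR_gt0.
Qed.

(** With [t = tanh b] this is 4 (cosh(x/2)^2 - t^2 sinh(x/2)^2), so that [edge_slope] is the
    derivative of 2 artanh(t tanh(x/2)). *)
Definition edge_den b x : R :=
  (1 - tanh b ^+ 2) * (expR x + expR (- x)) + 2 + 2 * tanh b ^+ 2.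

Definition edge_slope b x : R := 4 * tanh b / edge_den b x.

Lemma tanh_itv b : 0 < b -> 0 < tanh b < 1.
Proof.
move=> b0; have := expR_gt0 b; have := expR_gt0 (- b).
have : expR (- b) < expR b by rewrite ltr_expR; lra.
move=> h1 h2 h3; rewrite /tanh; apply/andP; split.
  by rewrite divr_gt0; lra.
by rewrite ltr_pdivrMr; lra.
Qed.

Lemma tanh_le x y : x <= y -> tanh x <= tanh y.
Proof.
move=> xy; rewrite /tanh !expRN.
have ex := expR_gt0 x; have ey := expR_gt0 y.
have exy : expR x <= expR y by rewrite ler_expR.
have E (z : R) : 0 < z -> (z - z^-1) / (z + z^-1) = 1 - 2 / (z ^+ 2 + 1).
  move=> z0; field; have z2 : 0 < z ^+ 2 by rewrite exprn_gt0.
  have h : z != 0 by rewrite gt_eqF.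
  by rewrite h andbT gt_eqF// ltr_wpDl// ltW.
rewrite !E// lerB// ler_pM2l// lef_pV2 ?posrE; nra.
Qed.

Lemma is_derive_edge_map b x :
  is_derive x 1 (edge_map b) (edge_slope b x).
Proof.
have D a c : 0 < a -> 0 < c -> is_derive x 1 (fun z => ln (a * expR z + c))
    ((a * expR x + c)^-1 * (a * expR x)).
  move=> a0 c0; have h : is_derive x 1 (fun z => a * expR z + c) (a * expR x).
    have -> : (fun z => a * expR z + c) = (a *: expR) + cst c by apply/funext.
    by apply: is_derive_eq; rewrite addr0.
  have h' := @is_derive1_ln R (a * expR x + c).
  apply: (@is_derive1_comp R (@ln R) (fun z => a * expR z + c) x _ _ _ h).
  by apply: h'; rewrite addr_gt0// mulr_gt0// expR_gt0.
have -> : edge_map b = (fun z => ln (expR b * expR z + expR (- b))) -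
    (fun z => ln (expR (- b) * expR z + expR b)).
  by apply/funext => z; rewrite edge_mapE.
have := D _ _ (expR_gt0 b) (expR_gt0 (- b)).
have := D _ _ (expR_gt0 (- b)) (expR_gt0 b) => D1 D2.
apply: is_derive_eq.
rewrite /edge_slope /edge_den /tanh !expRN.
have ex := expR_gt0 x; have eb := expR_gt0 b.
field.
have bb := mulr_gt0 eb eb.
rewrite !gt_eqF//=; first by rewrite addr_gt0.
set p := expR b * expR b in bb *; set q := expR x in ex *.
have -> : (p + 1) ^+ 2 - (p - 1) ^+ 2 = 4 * p by ring.
have qq := mulr_gt0 ex ex; rewrite -addrA ltr_pwDl//.
  by rewrite !mulr_gt0// addr_gt0.
have h1 := mulr_ge0 (sqr_ge0 (p + 1)) (ltW ex).
have h2 := mulr_ge0 (sqr_ge0 (p - 1)) (ltW ex).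
lra.
Qed.

Lemma edge_den_ge b x : 0 < b ->
  4 + (1 - tanh b ^+ 2) * x ^+ 2 <= edge_den b x.
Proof.
rewrite /edge_den =>  /tanh_itv/andP[t0 t1]; have := expRD_expRN_ge x.
have : 0 < 1 - tanh b ^+ 2 by nra.
nra.
Qed.

Lemma edge_slope_le b x : 0 < b ->
  edge_slope b x <= tanh b / (1 + (1 - tanh b ^+ 2) * x ^+ 2 / 4).
Proof.
move=> b0; have := edge_den_ge x b0.
case/andP: (tanh_itv b0) => t0 t1.
have k0 : 0 < 1 - tanh b ^+ 2 by nra.
rewrite /edge_slope; set D := edge_den b x => h.
have d0 : 0 < 1 + (1 - tanh b ^+ 2) * x ^+ 2 / 4.
  by rewrite ltr_pwDl// divr_ge0// mulr_ge0// ?sqr_ge0// ltW.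
have D0 : 0 < D by lra.
rewrite ler_pdivlMr// mulrAC ler_pdivrMr//.
by have := ler_wpM2l (ltW t0) h; lra.
Qed.

Lemma edge_slope_gt0 b x : 0 < b -> 0 < edge_slope b x.
Proof.
move=> b0; have := edge_den_ge x b0.
case/andP: (tanh_itv b0) => t0 t1 h.
rewrite /edge_slope divr_gt0//; first by rewrite mulr_gt0.
apply: lt_le_trans h; rewrite ltr_pwDl// mulr_ge0 ?sqr_ge0//; nra.
Qed.

(** Concavity of [edge_map b] on the half-line: its slope depends on [x] only through
    [expR x + expR (- x)], which increases there. *)
Lemma edge_slope_nincr b x y : 0 < b -> 0 <= x <= y ->
  edge_slope b y <= edge_slope b x.
Proof.
move=> b0 /andP[x0 xy]; have dx := edge_den_ge x b0.
have dy := edge_den_ge y b0.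
case/andP: (tanh_itv b0) => t0 t1.
have k0 : 0 < 1 - tanh b ^+ 2 by nra.
have h z : 0 < 4 + (1 - tanh b ^+ 2) * z ^+ 2.
  by rewrite ltr_pwDl// mulr_ge0 ?sqr_ge0// ltW.
rewrite /edge_slope ler_pM2l; last by rewrite mulr_gt0.
rewrite lef_pV2 ?posrE; [|exact: lt_le_trans dy|exact: lt_le_trans dx].
rewrite /edge_den 2!lerD2r ler_pM2l// !expRN.
have ex : 1 <= expR x by rewrite -expR0 ler_expR.
have exy : expR x <= expR y by rewrite ler_expR.
have ey : 0 < expR y by exact: expR_gt0.
have ex0 : 0 < expR x by exact: expR_gt0.
rewrite -subr_ge0.
have -> : expR y + (expR y)^-1 - (expR x + (expR x)^-1) =
   (expR y - expR x) * (expR x * expR y - 1) / (expR x * expR y).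
  by field; rewrite !gt_eqF.
rewrite divr_ge0 ?mulr_ge0 ?subr_ge0 ?(ltW ex0) ?(ltW ey)//.
by rewrite -[leLHS]mulr1 ler_pM// (le_trans ex).
Qed.

Lemma edge_map_nincr b x y : 0 < b -> x <= y -> edge_map b x <= edge_map b y.
Proof.
move=> b0 xy; apply: (@le_is_derive R _ (edge_slope b)) => // z _.
  exact: is_derive_edge_map.
by rewrite ltW// edge_slope_gt0.
Qed.

Lemma edge_map_ge0 b x : 0 < b -> 0 <= x -> 0 <= edge_map b x.
Proof. by move=> b0 x0; rewrite -(edge_map0 b) edge_map_nincr. Qed.

Lemma edge_map_le b x : 0 < b -> edge_map b x <= 2 * b.
Proof.
move=> b0; rewrite -[leRHS]expRK /edge_map.
have n0 := edge_map_num_gt0 b x; have := edge_map_num_gt0 (- b) x.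
rewrite opprK => d0.
rewrite ler_ln ?posrE ?divr_gt0// ?expR_gt0// ler_pdivrMr//.
have -> : 2 * b = b + b by ring.
have : 1 <= expR b by rewrite -expR0 ler_expR ltW.
rewrite expRD expRN; have ex := expR_gt0 x; have eb := expR_gt0 b => b1.
have -> : expR b * expR b * ((expR b)^-1 * expR x + expR b) =
   expR b * expR x + expR b ^+ 3 by field; rewrite gt_eqF.
rewrite lerD2l (@le_trans _ _ 1) ?exprn_ege1//.
by rewrite invf_le1.
Qed.

Lemma edge_map_le_lin b x : 0 < b -> 0 <= x -> edge_map b x <= tanh b * x.
Proof.
move=> b0 x0; rewrite -subr_ge0.
pose F z := tanh b * z - edge_map b z.
have -> : 0 = F 0 by rewrite /F edge_map0 mulr0 subr0.
apply: (@le_is_derive R F (fun z => tanh b - edge_slope b z) _ _ x0) => z _.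
  have -> : F = (tanh b *: id) - edge_map b by apply/funext.
  have := is_derive_edge_map b z => D.
  by apply: is_derive_eq; rewrite /GRing.scale/= mulr1.
rewrite subr_ge0 (le_trans (edge_slope_le _ b0))//.
case/andP: (tanh_itv b0) => t0 t1.
have k0 : 0 < 1 - tanh b ^+ 2 by nra.
rewrite ler_piMr//; first by lra.
by rewrite invf_le1 ?lerDl ?ltr_pwDl// divr_ge0// mulr_ge0 ?sqr_ge0// ltW.
Qed.

(** This is artanh u >= u at u = tanh b tanh(x/2). Both sides vanish at 0 and their derivatives have
    the same numerator, so it suffices to compare denominators. *)
Lemma edge_map_ge_tanh b x : 0 < b -> 0 <= x ->
  2 * tanh b * ((expR x - 1) / (expR x + 1)) <= edge_map b x.
Proof.
move=> b0 x0; rewrite -subr_ge0.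
case/andP: (tanh_itv b0) => t0 t1.
have k0 : 0 < 1 - tanh b ^+ 2 by nra.
pose F z := edge_map b z - 2 * tanh b * (1 - 2 * (expR z + 1)^-1).
have FE z : edge_map b z - 2 * tanh b * ((expR z - 1) / (expR z + 1)) = F z.
  by rewrite /F; field; rewrite gt_eqF// addr_gt0// expR_gt0.
have <- : F 0 = 0 by rewrite /F edge_map0 expR0; field.
rewrite FE.
apply: (@le_is_derive R F
  (fun z => edge_slope b z - 4 * tanh b * expR z / (expR z + 1) ^+ 2) _ _ x0) => z _.
  have h : expR z + 1 != 0 by rewrite gt_eqF// addr_gt0// expR_gt0.
  have D1 := is_derive_edge_map b z.
  have D2 : is_derive z 1 (fun z => expR z + 1) (expR z).
    have -> : (fun z : R => expR z + 1) = expR + cst 1 by apply/funext.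
    by apply: is_derive_eq; rewrite addr0.
  have D3 := @is_deriveV R (fun z => expR z + 1) z _ 1 h D2.
  have -> : F = edge_map b - (2 * tanh b) *: (cst 1 - 2 *: (fun z => (expR z + 1)^-1)).
    by apply/funext.
  apply: is_derive_eq; rewrite /GRing.scale/=; field.
  by [].
have ez := expR_gt0 z.
have e1 : 0 < expR z + 1 by rewrite addr_gt0.
have := edge_den_ge z b0; set D := edge_den b z => h.
have D0 : 0 < D.
  apply: lt_le_trans h; rewrite ltr_pwDl// mulr_ge0 ?sqr_ge0//; nra.
have -> : 4 * tanh b * expR z / (expR z + 1) ^+ 2 =
  4 * tanh b / (expR z + expR (- z) + 2).
  rewrite expRN; field; rewrite !gt_eqF//.
rewrite subr_ge0 /edge_slope ler_pM2l; last by rewrite pmulr_rgt0.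
have e0 := expR_gt0 (- z).
rewrite lef_pV2 ?posrE//; first by rewrite /D /edge_den; have := expRD_expRN_ge z; nra.
Qed.

(** The right-hand side is tanh(x/2)^2 = (c - 2) / (c + 2) with [c = expR x + expR (- x)]; it
    increases with [c], and [c >= 2 + x ^+ 2]. *)
Lemma sqr_tanh_half_ge x :
  x ^+ 2 / 4 / (1 + x ^+ 2 / 4) <= ((expR x - 1) / (expR x + 1)) ^+ 2.
Proof.
have := expRD_expRN_ge x; rewrite expRN; have ex := expR_gt0 x => h.
have e1 : 0 < expR x + 1 by rewrite addr_gt0.
rewrite exprMn exprVn ler_pdivlMr ?exprn_gt0// mulrAC ler_pdivrMr; last first.
  by rewrite ltr_pwDl// divr_ge0// sqr_ge0.
have : (2 + x ^+ 2) * expR x <= expR x ^+ 2 + 1.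
  have -> : expR x ^+ 2 + 1 = (expR x + (expR x)^-1) * expR x.
    by field; rewrite gt_eqF.
  by rewrite ler_pM2r.
nra.
Qed.

Lemma edge_map_sqr_norm b x : edge_map b x ^+ 2 = edge_map b `|x| ^+ 2.
Proof.
by case: (ger0P x) => _; rewrite ?edge_mapN ?sqrrN.
Qed.

Lemma edge_map_sqr_ge b x : 0 < b ->
  tanh b ^+ 2 * (x ^+ 2 / (1 + x ^+ 2 / 4)) <= edge_map b x ^+ 2.
Proof.
move=> b0; rewrite edge_map_sqr_norm -(real_normK (num_real x)).
have x0 := normr_ge0 x; set y := `|x| in x0 *.
have := edge_map_ge_tanh b0 x0.
case/andP: (tanh_itv b0) => t0 t1.
have ey : 1 <= expR y by rewrite -expR0 ler_expR.
set m := (X in 2 * _ * X) => h.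
have m0 : 0 <= m by rewrite /m divr_ge0//; lra.
have := sqr_tanh_half_ge y; rewrite -/m => mE.
apply: (@le_trans _ _ ((2 * tanh b * m) ^+ 2)).
  clearbody m; rewrite [leRHS](_ : _ = tanh b ^+ 2 * (2 ^+ 2 * m ^+ 2)); last by ring.
  rewrite ler_pM2l ?exprn_gt0//.
  apply: (@le_trans _ _ (2 ^+ 2 * (y ^+ 2 / 4 / (1 + y ^+ 2 / 4)))).
    by rewrite [leRHS]mulrA [X in _ <= X * _](_ : _ = y ^+ 2)//; field.
  by rewrite ler_pM2l.
by rewrite ler_sqr ?nnegrE// ?edge_map_ge0// mulr_ge0// mulr_ge0// ltW.
Qed.

Lemma edge_map_sqr_mono b x y : 0 < b -> `|x| <= `|y| ->
  edge_map b x ^+ 2 <= edge_map b y ^+ 2.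
Proof.
move=> b0 xy; rewrite edge_map_sqr_norm [leRHS]edge_map_sqr_norm.
by rewrite ler_sqr ?nnegrE ?edge_map_ge0// edge_map_nincr.
Qed.

(* Concavity on the half-line makes [edge_map b x / x] decreasing there. *)
Lemma edge_map_sqr_ratio b x y : 0 < b -> `|x| <= `|y| ->
  edge_map b y ^+ 2 * x ^+ 2 <= edge_map b x ^+ 2 * y ^+ 2.
Proof.
move=> b0; rewrite (edge_map_sqr_norm b x) (edge_map_sqr_norm b y).
rewrite -(real_normK (num_real x)) -(real_normK (num_real y)).
have := normr_ge0 x; have := normr_ge0 y.
move: `|x| `|y| => {}x {}y y0 x0 xy.
rewrite -!exprMn ler_sqr ?nnegrE ?mulr_ge0 ?edge_map_ge0//.
have secant : x * edge_slope b x <= edge_map b x.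
  pose F z := edge_map b z - z * edge_slope b x.
  suff : F 0 <= F x by rewrite /F edge_map0 mul0r subrr subr_ge0.
  apply: (@le_is_derive R F (fun z => edge_slope b z - edge_slope b x) _ _ x0) => z zx.
    have -> : F = edge_map b - edge_slope b x *: id.
      by apply/funext => t; rewrite /F mulrC.
    have := is_derive_edge_map b z => D.
    by apply: is_derive_eq; rewrite /GRing.scale/= mulr1.
  by rewrite subr_ge0 edge_slope_nincr.
pose G z := edge_map b x * z - x * edge_map b z.
suff : G x <= G y by rewrite /G [X in X - _]mulrC subrr subr_ge0 [edge_map b y * x]mulrC.
apply: (@le_is_derive R G (fun z => edge_map b x - x * edge_slope b z) _ _ xy) => z /andP[xz zy].
  have -> : G = edge_map b x *: id - x *: edge_map b by apply/funext.
  have := is_derive_edge_map b z => D.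
  by apply: is_derive_eq; rewrite /GRing.scale/= mulr1.
rewrite subr_ge0 (le_trans _ secant)// ler_wpM2l// edge_slope_nincr//.
by rewrite x0 xz.
Qed.

(** The condition on [c] is read off from a derivative. With [t = tanh b] and [k = 1 - t ^+ 2], the
    derivative of [F] below, multiplied by [q = 1 + k * z ^+ 2 / 4], is at least 2 z^3 (t^2 k / 4 -
    c (2 t^2 + b^2 k)). *)
Lemma edge_map_sqr_le b x c : 0 < b -> 0 <= c ->
  c * (8 * tanh b ^+ 2 + 4 * b ^+ 2 * (1 - tanh b ^+ 2)) <=
    tanh b ^+ 2 * (1 - tanh b ^+ 2) ->
  edge_map b x ^+ 2 <= tanh b ^+ 2 * (x ^+ 2 / (1 + c * x ^+ 2)).
Proof.
move=> b0 c0 cE; rewrite edge_map_sqr_norm -(real_normK (num_real x)).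
have x0 := normr_ge0 x; move: `|x| x0 => {}x x0.
case/andP: (tanh_itv b0) => t0 t1.
set t := tanh b in t0 t1 cE *; set k := 1 - t ^+ 2 in cE *.
have k0 : 0 < k by rewrite /k; nra.
rewrite mulrA ler_pdivlMr; last by rewrite ltr_pwDl// mulr_ge0// sqr_ge0.
rewrite -subr_ge0.
pose F z := t ^+ 2 * z ^+ 2 - edge_map b z ^+ 2 * (1 + c * z ^+ 2).
have -> : 0 = F 0 by rewrite /F edge_map0 expr0n /= !mulr0 mul0r subr0.
apply: (@le_is_derive R F (fun z => 2 * (t ^+ 2 * z
   - edge_map b z * edge_slope b z * (1 + c * z ^+ 2)
   - c * z * edge_map b z ^+ 2)) _ _ x0) => z /andP[z0 _].
  have -> : F = t ^+ 2 *: (id ^+ 2) - (edge_map b ^+ 2) * (cst 1 + c *: (id ^+ 2)).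
    by apply/funext.
  have := is_derive_edge_map b z => D.
  apply: is_derive_eq; rewrite /GRing.scale/= !expr1.
  rewrite -[(edge_map b ^+ 2) z]/(edge_map b z ^+ 2).
  rewrite -[(cst 1 + _) z]/(1 + c * z ^+ 2).
  ring.
have f0 := edge_map_ge0 b0 z0; have fL := edge_map_le z b0.
have := edge_map_le_lin b0 z0; rewrite -/t => ft; have s0 := edge_slope_gt0 z b0.
have := edge_slope_le z b0; rewrite -/t -/k.
set f := edge_map b z in f0 fL ft *; set s := edge_slope b z in s0 *.
rewrite ler_pdivlMr => [sE|]; last by rewrite ltr_pwDl// divr_ge0// mulr_ge0 ?sqr_ge0// ltW.
rewrite mulr_ge0//.
set q := 1 + k * z ^+ 2 / 4 in sE.
have q0 : 0 < q by rewrite /q ltr_pwDl// divr_ge0// mulr_ge0 ?sqr_ge0// ltW.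
rewrite -(pmulr_lge0 _ q0).
have fs : f * (s * q) <= t ^+ 2 * z.
  have := ler_pM f0 (mulr_ge0 (ltW s0) (ltW q0)) ft sE.
  by move/le_trans; apply; rewrite mulrAC -expr2.
(* The linear bound on [f] serves for the summand 1 of [q], the uniform bound [f <= 2 * b] for the
   quadratic summand. *)
have fq : f ^+ 2 * q <= z ^+ 2 * (t ^+ 2 + b ^+ 2 * k).
  have f1 : f ^+ 2 <= t ^+ 2 * z ^+ 2.
    by rewrite -exprMn ler_sqr ?nnegrE// mulr_ge0// ltW.
  have f2 : f ^+ 2 <= 4 * b ^+ 2.
    have -> : 4 * b ^+ 2 = (2 * b) ^+ 2 by ring.
    by rewrite ler_sqr ?nnegrE// mulr_ge0// ltW.
  have kz : 0 <= k * z ^+ 2 by rewrite mulr_ge0 ?sqr_ge0// ltW.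
  rewrite /q; nra.
have z2 := sqr_ge0 z.
have zz : 0 <= z * z ^+ 2 by rewrite mulr_ge0.
have e1 : f * (s * q) * (1 + c * z ^+ 2) <= t ^+ 2 * z * (1 + c * z ^+ 2).
  by rewrite ler_wpM2r// addr_ge0// mulr_ge0.
have e2 : c * z * (f ^+ 2 * q) <= c * z * (z ^+ 2 * (t ^+ 2 + b ^+ 2 * k)).
  by rewrite ler_wpM2l// mulr_ge0.
have e3 : c * (t ^+ 2 + t ^+ 2 + b ^+ 2 * k) * (z * z ^+ 2) <= t ^+ 2 * k / 4 * (z * z ^+ 2).
  rewrite ler_wpM2r//; have : 0 <= c * t ^+ 2 by rewrite mulr_ge0 ?sqr_ge0.
  lra.
rewrite /q in e1 e2 *; nra.
Qed.
End EdgeMap.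

(** * Second and fourth moments *)

Section Average.
Variables (R : realType) (Omega : finType).
Hypothesis Omega_gt0 : (0 < #|Omega|)%N.
Implicit Types (g h X : Omega -> R) (b c : R).

Definition avg g : R := #|Omega|%:R^-1 * \sum_w g w.

Lemma card_inv_gt0 : 0 < #|Omega|%:R^-1 :> R.
Proof. by rewrite invr_gt0 ltr0n. Qed.

Definition moment n X : R := avg (fun w => X w ^+ n).

Lemma avgD g h : avg (fun w => g w + h w) = avg g + avg h.
Proof. by rewrite /avg big_split mulrDr. Qed.

Lemma avgZ (a : R) g : avg (fun w => a * g w) = a * avg g.
Proof. by rewrite /avg -mulr_sumr mulrCA. Qed.

Lemma avg_cst (a : R) : avg (fun=> a) = a.
Proof.
rewrite /avg sumr_const -[a *+ _]mulr_natl mulKf//.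
by rewrite pnatr_eq0 -lt0n.
Qed.

Lemma eq_avg g h : g =1 h -> avg g = avg h.
Proof. by move=> gh; rewrite /avg; congr (_ * _); apply: eq_bigr. Qed.

Lemma avg_le g h : (forall w, g w <= h w) -> avg g <= avg h.
Proof.
by move=> gh; rewrite /avg ler_pM2l ?card_inv_gt0// ler_sum.
Qed.

Lemma avg_ge0 g : (forall w, 0 <= g w) -> 0 <= avg g.
Proof. by move=> g0; rewrite -(avg_cst 0) avg_le. Qed.

(** Twice a product of two sums is a double sum whose terms may be symmetrised in [u] and [w]. This
    yields Chebyshev's correlation inequalities from pointwise sign conditions. *)
Lemma avg_pair_le (a b c d : Omega -> R) :
  (forall u w, a u * b w + a w * b u <= c u * d w + c w * d u) ->
  avg a * avg b <= avg c * avg d.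
Proof.
move=> H.
suff : (\sum_u a u) * (\sum_w b w) <= (\sum_u c u) * (\sum_w d w).
  move=> h; rewrite /avg mulrACA [leRHS]mulrACA ler_pM2l// mulr_gt0// card_inv_gt0//.
have E (p q : Omega -> R) : (\sum_u p u) * (\sum_w q w) *+ 2 =
    \sum_u \sum_w (p u * q w + p w * q u).
  rewrite mulr2n big_distrlr/=; under [RHS]eq_bigr do rewrite big_split /=.
  by rewrite big_split/=; congr (_ + _); rewrite exchange_big.
rewrite -(ler_pMn2r (n := 2))// !E; apply: ler_sum => u _; exact: ler_sum.
Qed.

(** With [f] and [z] the squares of [edge_map b X] and [X], it is enough that E f^2 (E z)^2 <= E z^2
    (E f)^2. This is the product of two correlation inequalities, [I1] and [I2], which hold because
    [f] increases with [z] while the ratio of [f] to [z] decreases. *)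
Lemma avg_edge_map4 b X : 0 < b ->
  moment 4 X <= 3 * moment 2 X ^+ 2 ->
  moment 4 (fun w => edge_map b (X w)) <=
    3 * moment 2 (fun w => edge_map b (X w)) ^+ 2.
Proof.
move=> b0 H.
pose f w := edge_map b (X w) ^+ 2; pose z w := X w ^+ 2.
have f0 w : 0 <= f w by exact: sqr_ge0.
have z0 w : 0 <= z w by exact: sqr_ge0.
have fmono u w : z u <= z w -> f u <= f w /\ f w * z u <= f u * z w.
  move=> uw; have nn : `|X u| <= `|X w|.
    by rewrite -ler_sqr ?nnegrE// !real_normK ?num_real.
  by rewrite /f /z edge_map_sqr_mono// edge_map_sqr_ratio.
(* All three differences have the same sign, namely that of [z w - z u]. *)
have P u w : 0 <= (f w - f u) * (f u * z w - f w * z u) /\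
             0 <= (z w - z u) * (f u * z w - f w * z u).
  have [/[dup] + /fmono|/ltW/[dup] zz /fmono] := leP (z u) (z w).
  - by rewrite -subr_ge0 => zz [h1 h2]; split; apply: mulr_ge0; rewrite ?subr_ge0// -subr_ge0.
  move=> [h1 h2].
  by split; rewrite -mulrNN; apply: mulr_ge0; rewrite opprB subr_ge0.
have I1 : avg (fun w => f w ^+ 2) * avg z <= avg (fun w => f w * z w) * avg f.
  by apply: avg_pair_le => u w; have [h _] := P u w; nra.
have I2 : avg (fun w => f w * z w) * avg z <= avg (fun w => z w ^+ 2) * avg f.
  by apply: avg_pair_le => u w; have [_ h] := P u w; nra.
have e4 (y : R) : y ^+ 4 = (y ^+ 2) ^+ 2 by rewrite -exprM.
have E1 : moment 4 X = avg (fun w => z w ^+ 2).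
  by apply: eq_avg => w; rewrite e4.
have -> : moment 4 (fun w => edge_map b (X w)) = avg (fun w => f w ^+ 2).
  by apply: eq_avg => w; rewrite e4.
rewrite -[moment 2 (fun w => edge_map b (X w))]/(avg f).
move: H; rewrite E1 -[moment 2 X]/(avg z) => H.
have az0 : 0 <= avg z by exact: avg_ge0.
have af0 : 0 <= avg f by exact: avg_ge0.
have [az|az] := eqVneq (avg z) 0; last first.
  have azp : 0 < avg z by rewrite lt0r az.
  rewrite -(ler_pM2r azp) -(ler_pM2r azp).
  apply: (le_trans (ler_wpM2r az0 I1)).
  rewrite mulrAC; apply: (le_trans (ler_wpM2r af0 I2)).
  have := ler_wpM2r (sqr_ge0 (avg f)) H.
  move=> h; apply: (@le_trans _ _ (avg (fun w => z w ^+ 2) * avg f ^+ 2)).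
    by rewrite expr2 mulrA.
  by apply: (le_trans h); lra.
(* In the degenerate case, where division by [avg z] is impossible, [X] vanishes identically. *)
have zw w : z w = 0.
  apply/eqP; move/eqP: az; rewrite /avg mulf_eq0 gt_eqF ?card_inv_gt0//=.
  by rewrite psumr_eq0// => /allP/(_ w); rewrite mem_index_enum => /(_ isT).
have fw w : f w = 0.
  rewrite /f; have /eqP := zw w; rewrite sqrf_eq0 => /eqP ->.
  by rewrite edge_map0 expr0n.
have -> : avg (fun w => f w ^+ 2) = 0.
  by rewrite -(avg_cst 0); apply: eq_avg => w; rewrite fw expr0n.
by rewrite mulr_ge0// sqr_ge0.
Qed.

(** The function z / (1 + c z) is concave, so Jensen points the wrong way; the fourth moment makes
    up for it. From 1 / u >= 2 l - l^2 u with u = 1 + c z one gets a minorant quadratic in z =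
    X^2. *)
Lemma avg_saturation_ge (X : Omega -> R) (c : R) : 0 <= c ->
  moment 4 X <= 3 * moment 2 X ^+ 2 ->
  moment 2 X / (1 + 3 * c * moment 2 X) <= avg (fun w => X w ^+ 2 / (1 + c * X w ^+ 2)).
Proof.
move=> c0 H; set s := moment 2 X in H *; have s0 : 0 <= s by apply: avg_ge0 => w; exact: sqr_ge0.
have d0 : 0 < 1 + 3 * c * s by have := mulr_ge0 c0 s0; lra.
(* The value of [l] that maximises the averaged minorant 2 l s - l^2 s (1 + 3 c s). *)
pose l := (1 + 3 * c * s)^-1.
apply: (@le_trans _ _
  (avg (fun w => 2 * l * X w ^+ 2 - l ^+ 2 * X w ^+ 2 - l ^+ 2 * c * X w ^+ 4))).
  rewrite (@eq_avg _ (fun w =>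
    (2 * l - l ^+ 2) * X w ^+ 2 + (- l ^+ 2 * c) * X w ^+ 4)); last first.
    by move=> w; ring.
  rewrite avgD !avgZ -/(moment 2 X) -/(moment 4 X) -/s.
  apply: (@le_trans _ _ ((2 * l - l ^+ 2) * s + - l ^+ 2 * c * (3 * s ^+ 2))).
    by rewrite /l le_eqVlt; apply/orP; left; apply/eqP; field; rewrite gt_eqF.
  rewrite lerD2l !mulNr lerN2 ler_wpM2l//.
  by rewrite mulr_ge0// sqr_ge0.
apply: avg_le => w; have := sqr_ge0 (X w).
have -> : X w ^+ 4 = (X w ^+ 2) ^+ 2 by rewrite -exprM.
move: (X w ^+ 2) => z z0.
have q0 : 0 < 1 + c * z by rewrite ltr_pwDl// mulr_ge0.
rewrite ler_pdivlMr// -subr_ge0.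
rewrite (_ : _ - _ = z * (1 - l * (1 + c * z)) ^+ 2); last by ring.
by rewrite mulr_ge0// sqr_ge0.
Qed.

Lemma avg_edge_map2_ge b X : 0 < b ->
  moment 4 X <= 3 * moment 2 X ^+ 2 ->
  tanh b ^+ 2 * (moment 2 X / (1 + moment 2 X * 3 / 4)) <=
  moment 2 (fun w => edge_map b (X w)).
Proof.
move=> b0 H; set s := moment 2 X in H *.
have := @avg_saturation_ge X (4^-1) _ H; rewrite invr_ge0 => /(_ (ler0n _ _))/=; rewrite -/s.
rewrite (_ : 3 * 4^-1 * s = s * 3 / 4); last by field.
move=> h; apply: (le_trans (ler_wpM2l (sqr_ge0 _) h)).
rewrite -avgZ; apply: avg_le => w.
by rewrite [4^-1 * _]mulrC edge_map_sqr_ge.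
Qed.

Lemma avg_edge_map2_le b X c : 0 < b -> 0 <= c ->
  c * (8 * tanh b ^+ 2 + 4 * b ^+ 2 * (1 - tanh b ^+ 2)) <=
    tanh b ^+ 2 * (1 - tanh b ^+ 2) ->
  moment 2 (fun w => edge_map b (X w)) <=
  tanh b ^+ 2 * (moment 2 X / (1 + c * moment 2 X)).
Proof.
move=> b0 c0 cE; set s := moment 2 X; have s0 : 0 <= s by apply: avg_ge0 => w; exact: sqr_ge0.
have d0 : 0 < 1 + c * s by rewrite ltr_pwDl// mulr_ge0.
apply: (@le_trans _ _ (avg (fun w => tanh b ^+ 2 * (X w ^+ 2 / (1 + c * X w ^+ 2))))).
  by apply: avg_le => w; exact: edge_map_sqr_le.
rewrite avgZ ler_wpM2l ?sqr_ge0//.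
pose l := (1 + c * s)^-1.
(* Jensen's inequality done by hand: this affine function of [X w ^+ 2] is the tangent at [s] of the
   concave function z / (1 + c z). *)
apply: (@le_trans _ _ (avg (fun w => l ^+ 2 * X w ^+ 2 + c * s ^+ 2 * l ^+ 2))); last first.
  rewrite avgD avg_cst// avgZ -/(moment 2 X) -/s.
  rewrite /l le_eqVlt; apply/orP; left; apply/eqP; field.
  by rewrite gt_eqF.
apply: avg_le => w; have := sqr_ge0 (X w); move: (X w ^+ 2) => z z0.
have q0 : 0 < 1 + c * z by rewrite ltr_pwDl// mulr_ge0.
rewrite ler_pdivrMr// -subr_ge0.
rewrite (_ : _ - _ = c * (z - s) ^+ 2 * l ^+ 2).
  by rewrite mulr_ge0 ?sqr_ge0// mulr_ge0// sqr_ge0.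
by rewrite /l; field; rewrite gt_eqF.
Qed.
End Average.

(** * Independence and symmetry under uniform spins *)

Section Spins.
Variables (R : realType) (I : finType).
Local Notation Omega := {ffun I -> bool}.
Implicit Types (A B : pred I) (g h X Y : Omega -> R).

Lemma card_spins_gt0 : (0 < #|{: Omega}|)%N.
Proof. by apply/card_gt0P; exists [ffun=> true]. Qed.
Hint Resolve card_spins_gt0 : core.

Definition depends_on A g := forall s t : Omega,
  (forall i, A i -> s i = t i) -> g s = g t.

Definition odd_spin g := forall s : Omega, g [ffun i => ~~ s i] = - g s.

Lemma avg_odd g : odd_spin g -> avg g = 0.
Proof.
move=> og; rewrite /avg; apply/eqP; rewrite mulf_eq0; apply/orP; right.
pose fl (s : Omega) : Omega := [ffun i => ~~ s i].
have flK : involutive fl by move=> s; apply/ffunP => i; rewrite !ffunE negbK.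
have : \sum_s g s = - \sum_s g s.
  rewrite {1}(reindex_inj (inv_inj flK))/= -sumrN.
  by apply: eq_bigr => s _; rewrite og.
by move=> h; apply/eqP; lra.
Qed.

(* Swapping the coordinates in A between two copies of the configuration is a
   bijection that turns [g s * h t] into [g s * h s]. *)
Lemma avg_indep A B g h : depends_on A g -> depends_on B h ->
  (forall i, A i -> ~~ B i) ->
  avg (fun s => g s * h s) = avg g * avg h.
Proof.
move=> gA hB AB.
pose mix (s t : Omega) : Omega := [ffun i => if A i then s i else t i].
pose sw (p : Omega * Omega) := (mix p.1 p.2, mix p.2 p.1).
have swK : involutive sw.
  case=> s t; rewrite /sw /mix/=; congr (_, _); apply/ffunP => i;
    by rewrite !ffunE; case: (A i).
have : \sum_(p : Omega * Omega) g p.1 * h p.1 = \sum_(p : Omega * Omega) g p.1 * h p.2.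
  rewrite (reindex sw)/=; last by exists sw => p _; rewrite swK.
  apply: eq_bigr => -[s t] _ /=.
  congr (_ * _); first by apply: gA => i Ai; rewrite ffunE Ai.
  by apply: hB => i Bi; rewrite ffunE; case: ifP => // /AB; rewrite Bi.
rewrite -(pair_bigA _ (fun s t => g s * h t))/=.
rewrite -(pair_bigA _ (fun s t => g s * h s))/= => E.
have n0 : #|{: Omega}|%:R != 0 :> R by rewrite pnatr_eq0 -lt0n.
rewrite /avg mulrACA big_distrlr/= -E.
under [in RHS]eq_bigr do rewrite sumr_const.
by rewrite sumrMnl -[(\sum_i _) *+ _]mulr_natl -mulrA (mulKf n0).
Qed.

(** The constant 3 is the Gaussian value, and the one for which the bound passes to independent
    sums. *)
Definition kurtosis_le3 X :=
  moment 4 X <= 3 * moment 2 X ^+ 2.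

Lemma indep_sum2 A B X Y : depends_on A X -> depends_on B Y ->
  (forall i, A i -> ~~ B i) -> odd_spin Y ->
  moment 2 (fun s => X s + Y s) =
    moment 2 X + moment 2 Y.
Proof.
move=> XA YB AB oY.
have -> : moment 2 (fun s => X s + Y s) =
   avg (fun s => X s ^+ 2 + (2 * (X s * Y s) + Y s ^+ 2)).
  by apply: eq_avg => s; ring.
by rewrite !avgD avgZ (avg_indep XA YB AB) (avg_odd oY) !mulr0 add0r.
Qed.

(** Oddness kills the mixed terms of odd degree, leaving E X^4 + 6 E X^2 E Y^2 + E Y^4; the cross
    term is exactly that of 3 (E X^2 + E Y^2)^2. *)
Lemma indep_sum4 A B X Y : depends_on A X -> depends_on B Y ->
  (forall i, A i -> ~~ B i) -> odd_spin X -> odd_spin Y ->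
  kurtosis_le3 X -> kurtosis_le3 Y -> kurtosis_le3 (fun s => X s + Y s).
Proof.
move=> XA YB AB oX oY X4 Y4.
rewrite /kurtosis_le3 (indep_sum2 XA YB AB oY) {1}/moment.
have pX n : depends_on A (fun s => X s ^+ n).
  by move=> s t st; rewrite (XA s t).
have pY n : depends_on B (fun s => Y s ^+ n).
  by move=> s t st; rewrite (YB s t).
have oY3 : odd_spin (fun s => Y s ^+ 3).
  by move=> s; rewrite oY exprNn -signr_odd mulN1r.
have -> : avg (fun s => (X s + Y s) ^+ 4) =
   avg (fun s => X s ^+ 4 + (4 * (X s ^+ 3 * Y s) + (6 * (X s ^+ 2 * Y s ^+ 2)
     + (4 * (X s * Y s ^+ 3) + Y s ^+ 4)))).
  by apply: eq_avg => s; ring.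
rewrite !avgD !avgZ (avg_indep (pX 3%N) YB AB) (avg_indep (pX 2%N) (pY 2%N) AB).
rewrite (avg_indep XA (pY 3%N) AB) (avg_odd oY) (avg_odd oY3) !mulr0 !add0r.
rewrite -/(moment 4 X) -/(moment 4 Y) -/(moment 2 X) -/(moment 2 Y).
by move: X4 Y4; rewrite /kurtosis_le3; lra.
Qed.

Lemma indep_sum (V : eqType) (r : seq V) (A : V -> pred I) (Y : V -> Omega -> R) :
  uniq r -> (forall v w i, A v i -> A w i -> v = w) ->
  {in r, forall v, depends_on (A v) (Y v)} ->
  {in r, forall v, odd_spin (Y v)} -> {in r, forall v, kurtosis_le3 (Y v)} ->
  let X s := \sum_(v <- r) Y v s in
  [/\ moment 2 X = \sum_(v <- r) avg (fun s => Y v s ^+ 2),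
      odd_spin X & kurtosis_le3 X].
Proof.
move=> + AI.
(* The induction must also carry the set of spins that the partial sum depends on, to keep it
   independent of the next term. *)
suff H : uniq r -> {in r, forall v, depends_on (A v) (Y v)} ->
    {in r, forall v, odd_spin (Y v)} -> {in r, forall v, kurtosis_le3 (Y v)} ->
    [/\ depends_on (fun i => has (A^~ i) r) (fun s => \sum_(v <- r) Y v s),
    moment 2 (fun s => \sum_(v <- r) Y v s) = \sum_(v <- r) moment 2 (Y v),
    odd_spin (fun s => \sum_(v <- r) Y v s) & kurtosis_le3 (fun s => \sum_(v <- r) Y v s)].
  by move=> /H{}H /H{}H /H{}H /H[].
elim: r => [_ _ _ _|v r IH /=/andP[vr /IH{}IH] YA oY Y4].
  have z n : moment n.+1 (fun s : Omega => \sum_(v <- [::]) Y v s) = 0.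
    by rewrite -[RHS](avg_cst card_spins_gt0 0); apply: eq_avg => s; rewrite big_nil exprS mul0r.
  split => [s t _|||]; first by rewrite !big_nil.
  - by rewrite z big_nil.
  - by move=> s; rewrite !big_nil oppr0.
  - by rewrite /kurtosis_le3 !z expr0n mulr0.
have vvr : v \in v :: r by rewrite mem_head.
have sub x : x \in r -> x \in v :: r by rewrite in_cons => ->; rewrite orbT.
have [dX X2 oX X4] := IH (sub_in1 sub YA) (sub_in1 sub oY) (sub_in1 sub Y4).
have E : (fun s => \sum_(w <- v :: r) Y w s) = (fun s => Y v s + \sum_(w <- r) Y w s).
  by apply/funext => s; rewrite big_cons.
have AB i : A v i -> ~~ has (A^~ i) r.
  by move=> vi; apply/hasPn => w wr; apply/negP => wi; move: vr; rewrite (AI v w i)// wr.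
split.
- move=> s t st; rewrite !big_cons; congr (_ + _).
    by apply: (YA v vvr) => i vi; apply: st; rewrite vi.
  by apply: dX => i ri; apply: st; rewrite ri orbT.
- by rewrite E (indep_sum2 (YA v vvr) dX AB oX) X2 big_cons.
- by move=> s; rewrite !big_cons (oY v vvr) oX opprD.
- by rewrite E; apply: (indep_sum4 (YA v vvr) dX AB) => //; [exact: oY|exact: Y4].
Qed.
End Spins.

(** * The Gibbs recursion *)

Section TreeFacts.
Variable T : rootedTree.
Implicit Types v w : T.

Lemma mem_children v w : (w \in children v) = (w != origin T) && (parent w == v).
Proof.
rewrite in_fset_set; last exact: locally_finite.
apply/idP/idP => [|/andP[/eqP h1 /eqP h2]]; rewrite inE//.
by move=> [h1 h2]; apply/andP; split; apply/eqP.
Qed.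

Lemma childrenP v w : reflect (edge v w) (w \in children v).
Proof.
by rewrite mem_children; apply: (iffP andP) => -[/eqP h1 /eqP h2].
Qed.

Lemma depth_gt0 v : (0 < depth v)%N = (v != origin T).
Proof.
apply/idP/idP; last by apply: contraNT; rewrite lt0n negbK => /eqP/depth_eq0 ->.
by apply: contraTneq => ->; rewrite depth_origin.
Qed.

Lemma depth_child v w : w \in children v -> depth w = (depth v).+1.
Proof. by move=> /childrenP/depth_edge. Qed.

Lemma depth_parent w : w != origin T -> depth w = (depth (parent w)).+1.
Proof. by move=> wo; apply: depth_child; rewrite mem_children wo eqxx. Qed.

Lemma prod_bdryS (R : comRingType) k (h : T -> R) :
  \prod_(w <- bdry T k.+1) h w = \prod_(v <- bdry T k) \prod_(w <- children v) h w.
Proof.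
have E v : v \in bdry T k -> \prod_(w <- children v) h w =
    \prod_(w <- bdry T k.+1) if parent w == v then h w else 1.
  rewrite in_bdry => /eqP dv; rewrite -big_mkcond -[RHS]big_filter/=.
  apply: perm_big; apply: uniq_perm; rewrite ?filter_uniq ?fset_uniq// => w.
  rewrite mem_filter in_bdry mem_children andbC; apply: andb_id2l => /eqP pw.
  apply/idP/eqP => [/depth_parent ->|dw]; first by rewrite pw dv.
  by rewrite -depth_gt0 dw.
rewrite [RHS]big_seq (eq_bigr _ E) -big_seq exchange_big/=.
rewrite [LHS]big_seq [RHS]big_seq; apply: eq_bigr => w; rewrite in_bdry => /eqP dw.
rewrite -big_mkcond/= (eq_bigl (pred1 (parent w))); last by move=> v; rewrite /= eq_sym.
rewrite -big_filter filter_pred1_uniq ?fset_uniq ?big_seq1//.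
have : w != origin T by rewrite -depth_gt0 dw.
by rewrite in_bdry -eqSS => /depth_parent <-; apply/eqP.
Qed.

End TreeFacts.

(** * Averaging over spins one at a time *)

Section SpinField.
Variables (R : realType) (T : rootedTree) (N : nat).
Implicit Types (s : T -> bool) (v w : T) (c : bool).

(** Spins become functions on all of [T], so that the recursions along the tree carry no membership
    proofs; [true] is a default value outside the truncation. *)
Definition lift_config (eta : config T N) : T -> bool :=
  fun v => oapp eta true (insub v).

Lemma lift_configE eta (v : trunc T N) : lift_config eta (val v) = eta v.
Proof. by rewrite /lift_config valK. Qed.

Definition avg_spin (g : (T -> bool) -> R) : R :=
  avg (fun eta : config T N => g (lift_config eta)).

Definition set_spin v c s : T -> bool := fun x => if x == v then c else s x.

(** Flipping the spin at [v] is an involution of the configurations; a configuration and its flip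
    together supply both values at [v]. *)
Lemma avg_set_spin v (g : (T -> bool) -> R) : v \in trunc T N ->
  avg_spin g =
  avg_spin (fun s => 2^-1 * (g (set_spin v true s) + g (set_spin v false s))).
Proof.
move=> vN; pose v' : trunc T N := [` vN]%fset.
pose fl (eta : config T N) : config T N :=
  [ffun i => if i == v' then ~~ eta i else eta i].
have flK : involutive fl.
  by move=> eta; apply/ffunP => i; rewrite !ffunE; case: (i == v'); rewrite ?negbK.
have liftfl eta : lift_config (fl eta) = set_spin v (~~ lift_config eta v) (lift_config eta).
  apply/funext => x; rewrite /set_spin.
  have -> : lift_config eta v = eta v' by rewrite -[v]/(val v') lift_configE.
  rewrite /lift_config; case: insubP => [u _ <-|xN]/=.
    by rewrite ffunE -[v]/(val v') val_eqE; case: eqP => [->|].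
  by case: eqP => // xv; rewrite xv vN in xN.
have set_id s : set_spin v (s v) s = s.
  by apply/funext => x; rewrite /set_spin; case: eqP => [->|].
rewrite /avg_spin avgZ avgD.
have : \sum_eta g (lift_config eta) = \sum_(eta : config T N) g (lift_config (fl eta)).
  by rewrite (reindex_inj (inv_inj flK)).
move=> E; rewrite -avgD /avg big_split/=.
set S := \sum_w g (lift_config w).
have -> : \sum_w g (set_spin v true (lift_config w)) + \sum_w g (set_spin v false (lift_config w))
  = S + S.
  rewrite {2}/S E /S -!big_split/=; apply: eq_bigr => eta _; rewrite liftfl.
  rewrite -[in g (lift_config eta)](set_id (lift_config eta)).
  by case: (lift_config eta v); rewrite //= addrC.
by rewrite mulrCA -[S + S](mulr2n) -[S *+ 2]mulr_natl mulKf.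
Qed.

(** Fubini over the spins in [r]: the spin at [w] enters only through the last argument of its own
    factor [K w], so every factor is averaged separately. *)
Lemma avg_prod_spin (r : seq T) (H : (T -> bool) -> R)
    (K : T -> (T -> bool) -> bool -> R) :
  uniq r -> {subset r <= trunc T N} ->
  (forall v c s, v \in r -> H (set_spin v c s) = H s) ->
  (forall v w c s t, v \in r -> w \in r -> K w (set_spin v c s) t = K w s t) ->
  avg_spin (fun s => H s * \prod_(w <- r) K w s (s w)) =
  avg_spin (fun s => H s * \prod_(w <- r) (2^-1 * (K w s true + K w s false))).
Proof.
elim: r H => [|a r IH] H /=; first by move=> *; apply: eq_avg => eta; rewrite !big_nil.
move=> /andP[ar ur] sub HE KE.
have aN : a \in trunc T N by apply: sub; rewrite mem_head.
rewrite (avg_set_spin _ aN).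
(* The factor already averaged is absorbed into the prefactor, to which the induction hypothesis
   applies. *)
pose H' s := H s * (2^-1 * (K a s true + K a s false)).
have := IH H' ur; rewrite /H' => {}IH.
transitivity (avg_spin (fun s => H' s * \prod_(w <- r) K w s (s w))).
  apply: eq_avg => eta; move: (lift_config eta) => s.
  have E c : \prod_(w <- a :: r) K w (set_spin a c s) (set_spin a c s w) =
      K a s c * \prod_(w <- r) K w s (s w).
    rewrite big_cons KE ?mem_head// {1}/set_spin eqxx; congr (_ * _).
    rewrite big_seq [RHS]big_seq; apply: eq_bigr => w wr.
    rewrite KE ?mem_head// ?in_cons ?wr ?orbT// /set_spin.
    by case: eqP => // wa; rewrite -wa wr in ar.
  by rewrite !E !HE ?mem_head// /H'; ring.
rewrite /H' IH.
- by apply: eq_avg => eta; rewrite big_cons; ring.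
- by move=> x xr; apply: sub; rewrite in_cons xr orbT.
- by move=> v c s vr; rewrite HE ?KE ?mem_head// in_cons vr orbT.
- by move=> v w c s t vr wr; rewrite KE// in_cons ?vr ?wr orbT.
Qed.
End SpinField.

(** * Conditional law of the root given the boundary *)

Section Gibbs.
Variables (R : realType) (T : rootedTree) (J : T -> R) (beta : R).
Implicit Types (s : T -> bool) (v w : T) (c : bool).

Local Notation bJ w := (beta * J w).

(* [cavity s n v c]: the normalised sum of weights over the n levels below v,
   given spin c at v and the spins s on the lowest level *)
Fixpoint cavity s n v c : R :=
  if n is n.+1 then \prod_(w <- children v)
    (2^-1 * (expR (bJ w * spin R c * spin R true) * cavity s n w true +
             expR (bJ w * spin R c * spin R false) * cavity s n w false))
  else (c == s v)%:R.

(* the log-likelihood ratio sent by w to its parent when w has n levels below *)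
Fixpoint message n w s : R :=
  if n is n.+1 then edge_map (bJ w) (\sum_(u <- children w) message n u s)
  else 2 * bJ w * spin R (s w).

Definition field n v s : R := \sum_(w <- children v) message n w s.

Definition cavity_out s n w c : R :=
  2^-1 * (expR (bJ w * spin R c * spin R true) * cavity s n w true +
          expR (bJ w * spin R c * spin R false) * cavity s n w false).

(** The induction runs on [cavity_out] and not on [cavity], because at a boundary vertex one of the
    two values of [cavity] is 0 and the log-likelihood ratio is infinite. Once an edge is crossed,
    both values are positive. *)
Lemma cavity_message s n w :
  [/\ 0 < cavity_out s n w true, 0 < cavity_out s n w false &
    cavity_out s n w true = expR (message n w s) * cavity_out s n w false].
Proof.
have e0 := @expR_gt0 R.
elim: n w => [|n IH] w.
  rewrite /cavity_out /= /spin; case: (s w) => /=;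
    rewrite ?mulr1 ?mulr0 ?addr0 ?add0r ?mulrN1 ?opprK; split; rewrite ?mulr_gt0//;
    rewrite mulrCA -expRD; congr (_ * expR _); ring.
have P c : cavity s n.+1 w c = \prod_(u <- children w) cavity_out s n u c by [].
have P0 c : 0 < cavity s n.+1 w c.
  by rewrite P prodr_gt0// => u _; case: (IH u); case: c.
have PE : cavity s n.+1 w true = expR (field n w s) * cavity s n.+1 w false.
  rewrite !P /field expR_sum -big_split; apply: eq_bigr => u _.
  by case: (IH u).
have Q c : 0 < cavity_out s n.+1 w c.
  by rewrite /cavity_out mulr_gt0// addr_gt0// mulr_gt0.
split=> //.
rewrite /= /edge_map -/(field n w s).
have d0 x : 0 < expR (- (bJ w)) * expR x + expR (bJ w).
  by rewrite addr_gt0// mulr_gt0.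
have n0 x : 0 < expR (bJ w) * expR x + expR (- (bJ w)).
  by rewrite addr_gt0// mulr_gt0.
rewrite lnK ?posrE ?divr_gt0//.
rewrite /cavity_out PE /spin !mulr1 !mulrN1 opprK; field.
by rewrite gt_eqF.
Qed.

Lemma cavity_field s n v : 0 < cavity s n.+1 v false /\
  cavity s n.+1 v true = expR (field n v s) * cavity s n.+1 v false.
Proof.
have P c : cavity s n.+1 v c = \prod_(u <- children v) cavity_out s n u c by [].
split; first by rewrite P prodr_gt0// => u _; case: (cavity_message s n u).
rewrite !P /field expR_sum -big_split; apply: eq_bigr => u _.
by case: (cavity_message s n u).
Qed.

Variable N : nat.
Local Notation E := (@avg_spin R T N).

Definition edge_weight s w : R := expR (bJ w * spin R (s (parent w)) * spin R (s w)).

Definition weight_upto k s : R :=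
  \prod_(w <- trunc T N | (0 < depth w <= k)%N) edge_weight s w.

Lemma filter_trunc k : (k <= N)%N ->
  perm_eq [seq w <- trunc T N | depth w == k] (bdry T k).
Proof.
move=> kN; apply: uniq_perm; rewrite ?filter_uniq ?fset_uniq// => w.
rewrite mem_filter in_bdry in_trunc; case: eqP => //= ->; exact: kN.
Qed.

Lemma weight_uptoS k s : (k < N)%N ->
  weight_upto k.+1 s = weight_upto k s * \prod_(w <- bdry T k.+1) edge_weight s w.
Proof.
move=> kN; rewrite /weight_upto (bigID (fun w => depth w == k.+1))/= mulrC; congr (_ * _).
  apply: eq_bigl => w; rewrite -andbA; congr (_ && _).
  by rewrite andbC -ltn_neqAle ltnS.
rewrite -(perm_big _ (filter_trunc kN))/= big_filter; apply: eq_bigl => w.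
by case: eqP => [->|]; rewrite ?andbF// leqnn.
Qed.

(** Sums out the spins of level [k.+1]. Each of them meets only the edge to its parent and its own
    [cavity], and averaging that product gives one factor of [cavity] one level higher. The boundary
    condition [t] stays fixed while [s] is averaged. *)
Lemma avg_level k c t : (k < N)%N ->
  E (fun s => (s (origin T) == c)%:R * weight_upto k.+1 s *
     \prod_(w <- bdry T k.+1) cavity t (N - k.+1) w (s w)) =
  E (fun s => (s (origin T) == c)%:R * weight_upto k s *
     \prod_(w <- bdry T k) cavity t (N - k) w (s w)).
Proof.
move=> kN.
pose H s := (s (origin T) == c)%:R * weight_upto k s.
pose K w s d := expR (bJ w * spin R (s (parent w)) * spin R d) * cavity t (N - k.+1) w d.
(* The parent of a vertex of level [k.+1] is not on that level, so no factor [K w] reads a resampled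
   spin through [parent w]. *)
have par w v : w \in bdry T k.+1 -> v \in bdry T k.+1 -> parent w != v.
  rewrite !in_bdry => /eqP dw /eqP dv; apply: contra_eq_neq dw => pwv.
  have [->|/depth_parent ->] := eqVneq w (origin T); first by rewrite depth_origin.
  by rewrite pwv dv eqSS gtn_eqF.
transitivity (E (fun s => H s * \prod_(w <- bdry T k.+1) K w s (s w))).
  apply: eq_avg => eta; rewrite weight_uptoS// /H /K big_split/=.
  by rewrite !mulrA.
rewrite avg_prod_spin ?fset_uniq//.
- apply: eq_avg => eta; congr (_ * _); rewrite prod_bdryS.
  rewrite big_seq [RHS]big_seq; apply: eq_bigr => v _.
  rewrite (_ : (N - k)%N = (N - k.+1).+1); last by rewrite subnSK.
  rewrite /=; rewrite big_seq [RHS]big_seq; apply: eq_bigr => w.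
  by rewrite mem_children /K => /andP[_ /eqP ->].
- by move=> w; rewrite in_bdry in_trunc => /eqP ->.
- move=> v d s vB; rewrite /H /weight_upto.
  have vo : origin T != v.
    by apply: contraTneq vB => <-; rewrite in_bdry depth_origin.
  rewrite /set_spin (negbTE vo); congr (_ * _).
  apply: eq_bigr => w /andP[w0 wk]; rewrite /edge_weight.
  move: vB; rewrite in_bdry => /eqP dv.
  have -> : (w == v) = false by apply: contraTF wk => /eqP ->; rewrite dv ltnn.
  have -> // : (parent w == v) = false.
  apply: contraTF wk => /eqP pw; rewrite depth_gt0 in w0.
  by rewrite (depth_parent w0) pw dv -ltnNge ltnW.
- move=> v w d s e vB wB; rewrite /K /set_spin.
  by rewrite (negbTE (par _ _ wB vB)).
Qed.

(** Iterates [avg_level] from the boundary up to the root; the factor 1/2 is the probability that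
    the root spin, averaged last, equals [c]. *)
Lemma avg_root c t :
  E (fun s => (s (origin T) == c)%:R * weight_upto N s *
     \prod_(w <- bdry T N) cavity t 0 w (s w)) =
  2^-1 * cavity t N (origin T) c.
Proof.
have H k : (k <= N)%N -> E (fun s => (s (origin T) == c)%:R * weight_upto k s *
     \prod_(w <- bdry T k) cavity t (N - k) w (s w)) =
  2^-1 * cavity t N (origin T) c.
  elim: k => [_|k IH kN]; last by rewrite avg_level// IH// ltnW.
  have b0 : perm_eq (bdry T 0) [:: origin T].
    apply: uniq_perm; rewrite ?fset_uniq// => w; rewrite in_bdry inE.
    by rewrite -[w == _]negbK -depth_gt0 -eqn0Ngt.
  have w0 s : weight_upto 0 s = 1.
    by rewrite /weight_upto big_pred0// => w; case: (depth w).
  rewrite (avg_set_spin _ (origin_trunc T N)).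
  rewrite /avg_spin (@eq_avg _ _ _ (fun=> 2^-1 * cavity t N (origin T) c)).
    by rewrite avg_cst// card_spins_gt0.
  move=> eta; rewrite !w0 !(perm_big _ b0) !big_seq1 /set_spin !eqxx subn0.
  by case: c => /=; rewrite ?mul1r ?mul0r ?addr0 ?add0r ?mulr1.
by have := H N (leqnn N); rewrite subnn.
Qed.

(** Indexes the edges by their lower endpoints: for given [w] only [parent w] can be the upper one,
    and the root has none. *)
Lemma weightE (eta : config T N) :
  weight J beta eta = weight_upto N (lift_config eta).
Proof.
rewrite /weight /weight_upto.
pose F v w := expR (bJ w * spin R (lift_config eta v) * spin R (lift_config eta w)).
transitivity (\prod_(e : trunc T N * trunc T N | `[< edge (val e.1) (val e.2) >])
    F (val e.1) (val e.2)).
  by apply: eq_bigr => -[v w] _; rewrite /F !lift_configE.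
rewrite big_mkcond -(pair_bigA _ (fun v w : trunc T N => if `[< edge (val v) (val w) >]
   then F (val v) (val w) else 1))/=.
rewrite exchange_big/= [RHS]big_mkcond [RHS]big_seq_fsetE/=.
apply: eq_bigr => w _.
have dw : (depth (val w) <= N)%N by rewrite -in_trunc; exact: valP.
rewrite dw andbT depth_gt0.
have [wo|wo] := eqVneq (val w) (origin T).
  by rewrite big1// => v _; case: asboolP => // -[].
have pN : parent (val w) \in trunc T N.
  by rewrite in_trunc ltnW// -(depth_parent wo).
rewrite (bigD1 [` pN]%fset)//= big1 ?mulr1.
  by case: asboolP => // -[]; split=> //; apply/eqP.
move=> v vp; case: asboolP => // -[_ pv].
by move: vp; rewrite -val_eqE/= pv eqxx.
Qed.

(** Writes the conditioning on the boundary as a product of the initial values of [cavity], the form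
    in which [avg_root] applies. *)
Lemma same_boundaryE (xi eta : config T N) :
  (same_boundary xi eta)%:R =
  \prod_(w <- bdry T N) cavity (lift_config eta) 0 w (lift_config xi w) :> R.
Proof.
rewrite /same_boundary /=; case: (boolP [forall v, _]) => [/forallP H|].
  rewrite big_seq big1// => w wB.
  have wN : w \in trunc T N by rewrite in_trunc; move: wB; rewrite in_bdry => /eqP ->.
  have := H [` wN]%fset; rewrite /= wB => /eqP.
  by rewrite -2!lift_configE/= => ->; rewrite eqxx.
rewrite negb_forall => /existsP[v]; rewrite negb_imply => /andP[vB xe].
apply/esym/eqP; rewrite prodf_seq_eq0; apply/hasP; exists (val v) => //=.
by rewrite !lift_configE (negbTE xe).
Qed.

Lemma sum_boundary_weight (eta : config T N) c :
  \sum_(xi : config T N | same_boundary xi eta && (xi (trunc_origin T N) == c))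
    weight J beta xi =
  #|{: config T N}|%:R * (2^-1 * cavity (lift_config eta) N (origin T) c).
Proof.
rewrite -avg_root /avg_spin /avg mulrA divff ?mul1r; last first.
  by rewrite pnatr_eq0 -lt0n card_spins_gt0.
rewrite big_mkcond; apply: eq_bigr => xi _.
rewrite -same_boundaryE -weightE -[origin T]/(val (trunc_origin T N)) lift_configE.
by case: eqP; case: same_boundary; rewrite ?mul1r ?mul0r ?mulr1 ?mulr0.
Qed.

Lemma same_boundary_eql (xi eta : config T N) : same_boundary xi eta ->
  (fun zeta : config T N => same_boundary zeta xi) =1
  (fun zeta : config T N => same_boundary zeta eta).
Proof.
move=> /forallP xe zeta; apply: eq_forallb => v.
by have := xe v; case: (_ \in _) => //= /eqP ->.
Qed.

Lemma same_boundary_sym (xi eta : config T N) :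
  same_boundary xi eta = same_boundary eta xi.
Proof. by apply: eq_forallb => v; rewrite eq_sym. Qed.

Lemma sg_prob_class (xi eta : config T N) : same_boundary xi eta ->
  sg_prob J beta xi = 2 ^- #|` bdry T N| / (\sum_(zeta : config T N |
    same_boundary zeta eta) weight J beta zeta) * weight J beta xi.
Proof.
by move=> xe; rewrite /sg_prob (eq_bigl _ _ (same_boundary_eql xe)) mulrAC mulrA.
Qed.

Lemma partition_functionE (eta : config T N) :
  \sum_(xi : config T N | same_boundary xi eta) weight J beta xi =
  #|{: config T N}|%:R * (2^-1 * (cavity (lift_config eta) N (origin T) true +
                                 cavity (lift_config eta) N (origin T) false)).
Proof.
rewrite (bigID (fun xi : config T N => xi (trunc_origin T N) == true))/=.
rewrite sum_boundary_weight !mulrDr; congr (_ + _).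
rewrite -sum_boundary_weight.
by apply: eq_bigl => xi; congr (_ && _); case: (xi _).
Qed.

Lemma config_card_gt0 : 0 < #|{: config T N}|%:R :> R.
Proof. by rewrite ltr0n card_spins_gt0. Qed.

(** On a boundary class [sg_prob] is a constant multiple of [weight], so only the ratio of the two
    root cavities survives. The case [N = 0], where the root is itself a boundary vertex, is
    excluded. *)
Lemma sg_origin_condE n (eta : config T N) : N = n.+1 ->
  sg_origin_cond J beta eta =
  let X := field n (origin T) (lift_config eta) in expR X / (expR X + 1).
Proof.
move=> Nn; rewrite /sg_origin_cond.
have D : \sum_(xi : config T N | same_boundary xi eta) sg_prob J beta xi =
    \sum_(xi : config T N | same_boundary xi eta) (2 ^- #|` bdry T N| /
    (\sum_(zeta : config T N | same_boundary zeta eta) weight J beta zeta) *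
    weight J beta xi).
  by apply: eq_bigr => xi; exact: sg_prob_class.
rewrite D (eq_bigr _ (fun xi xe => sg_prob_class (proj1 (andP xe)))).
rewrite -!mulr_sumr partition_functionE.
rewrite (eq_bigl (fun xi : config T N => same_boundary xi eta &&
   (xi (trunc_origin T N) == true))); last by move=> xi; rewrite eqb_id.
rewrite sum_boundary_weight.
have [] := cavity_field (lift_config eta) n (origin T); rewrite -Nn.
set q := cavity _ _ _ false => q0 ->.
set e := expR _; have e0 : 0 < e by exact: expR_gt0.
have c0 := config_card_gt0.
have t0 : 2 ^+ #|` bdry T N| != 0 :> R by rewrite expf_neq0// pnatr_eq0.
rewrite /=; field.
have eq0 := mulr_gt0 e0 q0.
by rewrite t0 !gt_eqF// addr_gt0.
Qed.


(** A boundary class pins the boundary coordinates and leaves the others free, so all classes have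
    the same size. *)
Lemma card_same_boundary (eta : config T N) :
  (#|[pred xi : config T N | same_boundary xi eta]| * 2 ^ #|` bdry T N| =
   #|{: config T N}|)%N.
Proof.
pose F (v : trunc T N) : pred bool :=
  if val v \in bdry T N then pred1 (eta v) else predT.
have -> : #|[pred xi : config T N | same_boundary xi eta]| = #|family F|.
  apply: eq_card => xi; rewrite !inE.
  apply: eq_forallb => v; rewrite -[RHS]/(xi v \in F v) /F.
  by case: (val v \in bdry T N).
have -> : #|family F| = (2 ^ #|[pred v : trunc T N | val v \notin bdry T N]|)%N.
  rewrite card_family foldrE big_map big_enum/= -sum1_card expn_sum/= [RHS]big_mkcond/=.
  apply: eq_bigr => v _; rewrite -[v \in [pred _ | _]]/(val v \notin bdry T N) /F.
  case: (val v \in bdry T N) => /=.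
    by rewrite card1.
  by rewrite card_bool expn1.
rewrite card_ffun card_bool -expnD; congr (2 ^ _)%N.
have -> : #|` bdry T N| = #|[pred v : trunc T N | val v \in bdry T N]|.
  rewrite -(perm_size (filter_trunc (leqnn N))) size_filter -sum1_count.
  rewrite -[RHS]sum1_card big_seq_fsetE/=.
  by apply: eq_bigl => v; rewrite inE in_bdry.
by rewrite addnC; exact: cardC.
Qed.

(* Every boundary condition has sg-probability equal to the uniform one. *)
Lemma sum_sg_prob (F : config T N -> R) :
  (forall xi eta, same_boundary xi eta -> F xi = F eta) ->
  \sum_(eta : config T N) sg_prob J beta eta * F eta = avg F.
Proof.
move=> Fcst; pose t : R := 2 ^+ #|` bdry T N|.
have t0 : t != 0 by rewrite expf_neq0// pnatr_eq0.
have c0 := config_card_gt0.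
have M (eta : config T N) : #|[pred xi : config T N | same_boundary xi eta]|%:R * t =
    #|{: config T N}|%:R :> R.
  by rewrite -(card_same_boundary eta) natrM natrX.
(* Every term is replaced by its mean over its boundary class, whose size is the inverse of the
   prefactor; after exchanging the sums the total weight of the class cancels the partition
   function. *)
have Mt (eta : config T N) (a : R) : a = t / #|{: config T N}|%:R *
    \sum_(xi : config T N | same_boundary xi eta) a.
  rewrite sumr_const -[a *+ _]mulr_natr -(M eta); field; rewrite t0/=.
  by have := c0; rewrite -(M eta) => /gt_eqF/negbT; rewrite mulf_eq0 negb_or => /andP[].
rewrite (eq_bigr _ (fun eta _ => Mt eta _)) -mulr_sumr.
rewrite (exchange_big_dep xpredT)//= /avg [t / _]mulrC -mulrA; congr (_ * _).
rewrite mulr_sumr; apply: eq_bigr => xi _.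
have -> : \sum_(eta : config T N | same_boundary xi eta) sg_prob J beta eta * F eta =
  t^-1 / (\sum_(zeta : config T N | same_boundary zeta xi) weight J beta zeta) *
  (\sum_(eta : config T N | same_boundary eta xi) weight J beta eta) * F xi.
  rewrite mulr_sumr mulr_suml; apply: eq_big => eta; first exact: same_boundary_sym.
  rewrite same_boundary_sym => ex.
  by rewrite (sg_prob_class ex) (Fcst _ _ ex).
have Z0 : 0 < \sum_(zeta : config T N | same_boundary zeta xi) weight J beta zeta.
  rewrite (bigD1 xi)/=; last by apply/forallP => v; rewrite eqxx implybT.
  rewrite ltr_pwDl ?sumr_ge0// => [|zeta _]; rewrite ?ltW// /weight prodr_gt0// => e _;
    exact: expR_gt0.
by field; rewrite t0 gt_eqF.
Qed.

Lemma sg_expectationE n (f : R -> R) : N = n.+1 ->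
  \sum_(eta : config T N) sg_prob J beta eta * f (sg_origin_cond J beta eta) =
  avg (fun eta : config T N =>
     f (let X := field n (origin T) (lift_config eta) in expR X / (expR X + 1))).
Proof.
move=> Nn; rewrite sum_sg_prob => [|xi eta xe].
  by apply: eq_avg => eta; rewrite (sg_origin_condE _ Nn).
rewrite /sg_origin_cond; congr (f (_ / _)).
  by apply: eq_bigl => zeta; rewrite (same_boundary_eql xe).
by apply: eq_bigl => zeta; rewrite (same_boundary_eql xe).
Qed.
End Gibbs.

(** * Second moments of the messages *)

Section MessageMoments.
Variables (R : realType) (T : rootedTree) (J : T -> R) (beta : R) (N : nat).
Hypothesis bJ_gt0 : forall w, w != origin T -> 0 < beta * J w.
Implicit Types v w : T.

Definition message_var n w (eta : config T N) : R :=
  message J beta n w (lift_config eta).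
Definition field_var n v (eta : config T N) : R :=
  field J beta n v (lift_config eta).

Definition message2 n w : R := moment 2 (message_var n w).
Definition field2 n v : R := moment 2 (field_var n v).

(** A fibre of [iter n parent]; fibres over distinct vertices are disjoint, which is the source of
    the independence of messages. *)
Definition below n w : pred (trunc T N) := fun i => iter n parent (val i) == w.

Lemma message_depends n w : depends_on (below n w) (message_var n w).
Proof.
elim: n w => [|n IH] w eta xi exi; rewrite /message_var /=.
  congr (_ * spin R _); rewrite /lift_config; case: insubP => [u _ uw|//]/=.
  by apply: exi; apply/eqP.
congr (edge_map _ _); rewrite big_seq [RHS]big_seq; apply: eq_bigr => u.
rewrite mem_children => /andP[_ /eqP pu]; apply: IH => i iu; apply: exi.
by rewrite /below iterS (eqP iu) pu.
Qed.

(** A message from the boundary has constant modulus, hence kurtosis 1; sums over children and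
    [edge_map] preserve both properties. The depth condition keeps the spins that are read inside
    the truncation, since the default spin outside is not odd. *)
Lemma message_odd_kurtosis n w : w != origin T -> (depth w + n <= N)%N ->
  odd_spin (message_var n w) /\ kurtosis_le3 (message_var n w).
Proof.
elim: n w => [|n IH] w wo wN.
  have wT : w \in trunc T N by rewrite in_trunc -[depth w]addn0.
  pose w' : trunc T N := [` wT]%fset.
  have E eta : message_var 0 w eta = 2 * (beta * J w) * spin R (eta w').
    by rewrite /message_var /=; congr (_ * spin R _); exact: (lift_configE eta w').
  split=> [eta|]; first by rewrite !E ffunE /spin; case: (eta _); rewrite ?mulrN1 ?mulr1 ?opprK.
  have s2 b : spin R b ^+ 2 = 1 by case: b; rewrite /spin ?sqrrN expr1n.
  have s4 b : spin R b ^+ 4 = 1 by rewrite (exprM _ 2 2) s2 expr1n.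
  rewrite /kurtosis_le3 /moment.
  rewrite (@eq_avg _ _ _ (fun=> (2 * (beta * J w)) ^+ 4)); last first.
    by move=> eta; rewrite E exprMn s4 mulr1.
  rewrite (@eq_avg _ _ (fun eta => message_var 0 w eta ^+ 2)
     (fun=> (2 * (beta * J w)) ^+ 2)); last by move=> eta; rewrite E exprMn s2 mulr1.
  rewrite !avg_cst ?card_spins_gt0// (exprM _ 2 2).
  by have := sqr_ge0 ((2 * (beta * J w)) ^+ 2); lra.
have C u : u \in children w -> u != origin T /\ (depth u + n <= N)%N.
  move=> uw; split; first by move: uw; rewrite mem_children => /andP[].
  by rewrite (depth_child uw) addSnnS.
have E eta : message_var n.+1 w eta = edge_map (beta * J w) (field_var n w eta) by [].
have [] := @indep_sum R (trunc T N) T (children w) (below n) (message_var n) (fset_uniq _).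
- by move=> v u i /eqP <- /eqP.
- by move=> u _; exact: message_depends.
- by move=> u /C[uo uN]; case: (IH u uo uN).
- by move=> u /C[uo uN]; case: (IH u uo uN).
move=> _ oX X4; split=> [eta|].
  by rewrite !E -edge_mapN; congr (edge_map _ _); exact: oX.
apply: avg_edge_map4; first exact: card_spins_gt0.
  exact: bJ_gt0.
exact: X4.
Qed.

Lemma field2_kurtosis n v : (depth v + n < N)%N ->
  field2 n v = \sum_(w <- children v) message2 n w /\ kurtosis_le3 (field_var n v).
Proof.
move=> vN.
have C u : u \in children v -> u != origin T /\ (depth u + n <= N)%N.
  move=> uw; split; first by move: uw; rewrite mem_children => /andP[].
  by rewrite (depth_child uw) addSn.
have [] := @indep_sum R (trunc T N) T (children v) (below n) (message_var n) (fset_uniq _).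
- by move=> x u i /eqP <- /eqP.
- by move=> u _; exact: message_depends.
- by move=> u /C[uo uN]; case: (message_odd_kurtosis uo uN).
- by move=> u /C[uo uN]; case: (message_odd_kurtosis uo uN).
by move=> h _ h4; split.
Qed.

Lemma message2_0 w : message2 0 w = 4 * (beta * J w) ^+ 2.
Proof.
rewrite /message2 /moment (@eq_avg _ _ _ (fun=> 4 * (beta * J w) ^+ 2)).
  by rewrite avg_cst// card_spins_gt0.
move=> eta; rewrite /message_var /= /spin; case: (lift_config eta w);
  rewrite ?mulr1 ?mulrN1 ?sqrrN; ring.
Qed.

Lemma message2_ge n w : w != origin T -> (depth w + n < N)%N ->
  tanh (beta * J w) ^+ 2 * (field2 n w / (1 + field2 n w * 3 / 4)) <=
  message2 n.+1 w.
Proof.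
move=> wo wN; have [_ k4] := field2_kurtosis wN.
by apply: avg_edge_map2_ge => //; [exact: card_spins_gt0|exact: bJ_gt0].
Qed.

Lemma message2_le n w c : w != origin T -> 0 <= c ->
  c * (8 * tanh (beta * J w) ^+ 2 + 4 * (beta * J w) ^+ 2 * (1 - tanh (beta * J w) ^+ 2)) <=
    tanh (beta * J w) ^+ 2 * (1 - tanh (beta * J w) ^+ 2) ->
  message2 n.+1 w <=
  tanh (beta * J w) ^+ 2 * (field2 n w / (1 + c * field2 n w)).
Proof.
move=> wo c0 cE.
by apply: avg_edge_map2_le => //; [exact: card_spins_gt0|exact: bJ_gt0].
Qed.

Lemma field2_ge0 n v : 0 <= field2 n v.
Proof. by apply: avg_ge0 => [|eta]; [exact: card_spins_gt0|exact: sqr_ge0]. Qed.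

Lemma message2_ge0 n w : 0 <= message2 n w.
Proof. by apply: avg_ge0 => [|eta]; [exact: card_spins_gt0|exact: sqr_ge0]. Qed.

Lemma message2_gt0 n w : (forall v, exists u, u \in children v) ->
  w != origin T -> (depth w + n <= N)%N -> 0 < message2 n w.
Proof.
move=> hasc; elim: n w => [|n IH] w wo wN.
  by rewrite message2_0 mulr_gt0// exprn_gt0// bJ_gt0.
apply: lt_le_trans (message2_ge wo _); last by rewrite -addnS.
have /andP[t0 _] := tanh_itv (bJ_gt0 wo).
have s0 : 0 < field2 n w.
  have [-> _] := @field2_kurtosis n w ltac:(by rewrite -addnS).
  have [u uw] := hasc w; rewrite (big_rem u)//= ltr_pwDl//.
    apply: IH; first by move: uw; rewrite mem_children => /andP[].
    by rewrite (depth_child uw) addSnnS.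
  by rewrite sumr_ge0// => *; exact: message2_ge0.
rewrite mulr_gt0 ?exprn_gt0// divr_gt0// ltr_pwDl// divr_ge0// mulr_ge0// ltW//.
Qed.

Lemma field2_gt0 n v : (forall v, exists u, u \in children v) ->
  (depth v + n < N)%N -> 0 < field2 n v.
Proof.
move=> hasc vN; have [-> _] := field2_kurtosis vN.
have [u uw] := hasc v; rewrite (big_rem u)//= ltr_pwDl//.
  apply: message2_gt0 => //; first by move: uw; rewrite mem_children => /andP[].
  by rewrite (depth_child uw) addSn.
by rewrite sumr_ge0// => *; exact: message2_ge0.
Qed.
End MessageMoments.

(** * Rays, resistances and capacity *)

Section Rays.
Variable T : rootedTree.
Implicit Types v w y : T.

Lemma child_parent w : w != origin T -> w \in children (parent w).
Proof. by move=> wo; rewrite mem_children wo eqxx. Qed.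

Lemma child_neq_origin v w : w \in children v -> w != origin T.
Proof. by rewrite mem_children => /andP[]. Qed.

Lemma child_parentE v w : w \in children v -> parent w = v.
Proof. by rewrite mem_children => /andP[_ /eqP]. Qed.

Lemma depth_parentE w : depth (parent w) = (depth w).-1.
Proof.
have [->|wo] := eqVneq w (origin T); first by rewrite parent_origin depth_origin.
by rewrite [in RHS](depth_parent wo).
Qed.

Lemma depth_iter_parent k w : depth (iter k parent w) = (depth w - k)%N.
Proof.
elim: k => [|k IH]; first by rewrite subn0.
by rewrite iterS depth_parentE IH subnS.
Qed.

Lemma tle_depth y w : tle y w -> (depth y <= depth w)%N.
Proof. by move=> [n <-]; rewrite depth_iter_parent leq_subr. Qed.

Lemma tle_parent y w : w != origin T -> tle y w <-> y = w \/ tle y (parent w).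
Proof.
move=> wo; split=> [[[|n] <-]|[->|[n <-]]].
- by left.
- by right; exists n; rewrite -iterSr.
- by exists 0%N.
- by exists n.+1; rewrite iterSr.
Qed.

Lemma tle_origin y : tle y (origin T) -> y = origin T.
Proof.
by move=> [n <-]; elim: n => //= n ->; exact: parent_origin.
Qed.

Lemma origin_tle w : tle (origin T) w.
Proof. by have [n /eqP] := to_origin w; exists n. Qed.

(** The path is read upwards from [v] and stops short of the root, which indexes no edge. These sums
    are the partial sums of the ray potentials. *)
Definition path_sum (R : pzRingType) (h : T -> R) v : R :=
  \sum_(0 <= i < depth v) h (iter i parent v).

Lemma path_sum_origin (R : pzRingType) (h : T -> R) : path_sum h (origin T) = 0.
Proof. by rewrite /path_sum depth_origin big_geq. Qed.

Lemma path_sum_child (R : pzRingType) (h : T -> R) w : w != origin T ->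
  path_sum h w = h w + path_sum h (parent w).
Proof.
move=> wo; rewrite /path_sum (depth_parent wo) big_nat_recl//=; congr (_ + _).
by apply: eq_bigr => i _; rewrite -iterS iterSr.
Qed.

Lemma ray_path_sum (R : pzRingType) (h : T -> R) (y : nat -> T) n : ray y ->
  depth (y n) = n /\ path_sum h (y n) = \sum_(0 <= i < n) h (y i.+1).
Proof.
move=> [y0 ye]; elim: n => [|n [dn IH]].
  by rewrite y0 depth_origin path_sum_origin big_geq.
have [no pn] := ye n; split; first by rewrite (depth_edge (ye n)) dn.
by rewrite path_sum_child ?pn ?IH ?big_nat_recr// 1?addrC//; apply/eqP.
Qed.

Hypothesis no_deadend : forall v, exists w, w \in children v.

Lemma exists_ray v : exists y : nat -> T, ray y /\ y (depth v) = v.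
Proof.
pose step u := projT1 (cid (no_deadend u)).
have stepP u : edge u (step u) by apply/childrenP; exact: (projT2 (cid (no_deadend u))).
(* Ancestors of [v] up to its depth, then chosen children for ever. *)
pose y m := if (m <= depth v)%N then iter (depth v - m) parent v
            else iter (m - depth v) step v.
exists y; split; last by rewrite /y leqnn subnn.
split.
  by rewrite /y leq0n subn0; apply: depth_eq0; rewrite depth_iter_parent subnn.
move=> n; rewrite /y; case: (ltngtP n (depth v)) => [nv|vn|->].
- have -> : (depth v - n = (depth v - n.+1).+1)%N by rewrite subnSK.
  rewrite iterS; split=> // /(congr1 (@depth T)).
  by rewrite depth_iter_parent depth_origin subKn.
- by rewrite subSn ?(ltnW vn)// iterS; exact: stepP.
- by rewrite subnn subSnn /=; exact: stepP.
Qed.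
End Rays.

Section NoDeadEnd.
Variable T : rootedTree.
Hypothesis T_infinite : infinite_set [set: T].
Hypothesis T_noleaf : forall v : T, v <> origin T -> ~ leaf v.

(** A vertex other than the root without children would have its parent as only neighbour; a root
    without children would be the whole tree. *)
Lemma no_deadend (v : T) : exists w, w \in children v.
Proof.
have [->|vo] := eqVneq v (origin T).
  apply: contrapT => H; apply: T_infinite.
  apply: (sub_finite_set _ (finite_set1 (origin T))) => w _ /=.
  apply: contrapT => /eqP wo; apply: H.
  exists (iter (depth w).-1 parent w); apply/childrenP; split.
    move/(congr1 (@depth T)); rewrite depth_iter_parent depth_origin.
    by rewrite (depth_parent wo) /= subSnn.
  by rewrite -iterS prednK ?depth_gt0//; apply: depth_eq0; rewrite depth_iter_parent subnn.
apply: contrapT => H; apply: (T_noleaf (v := v)); first exact/eqP.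
exists (parent v); split; first by right; split => //; exact/eqP.
by move=> w [/childrenP vw|[_ ->]//]; case: H; exists w.
Qed.
End NoDeadEnd.

(** * Recursion for the resistances *)

Section Resistance.
Variables (R : realType) (T : rootedTree) (J : T -> R) (beta : R).
Local Notation Res := (tanh_resistance J beta).
Implicit Types v w : T.

Lemma finite_tlt v : finite_set [set y | tlt (origin T) y /\ tle y v].
Proof.
apply: (sub_finite_set _ (finite_trunc T (depth v))) => y /= [_ /tle_depth]//.
Qed.

Lemma tanh_resistance_origin : Res (origin T) = 1.
Proof.
rewrite /tanh_resistance big_seq big_pred0// => y.
apply/negP; rewrite in_fset_set; last exact: finite_tlt.
by rewrite inE => -[[_ oy] /tle_origin yo]; apply: oy.
Qed.

Lemma tanh_resistance_child w : w != origin T ->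
  Res w = (tanh (beta * J w)) ^- 2 * Res (parent w).
Proof.
move=> wo; rewrite /tanh_resistance.
set S := fset_set _; set S' := fset_set [set y | _ /\ tle y (parent w)].
have wS' : w \notin S'.
  rewrite in_fset_set; last exact: finite_tlt.
  rewrite notin_setE /= => -[_ /tle_depth].
  by rewrite [leqLHS](depth_parent wo) ltnn.
rewrite -(big_fsetU1 _ (fun y => (tanh (beta * J y)) ^- 2) wS')/=.
congr (bigop _ _ _); congr (enum_fset _).
apply/fsetP => y; rewrite !inE !in_fset_set; do ?exact: finite_tlt.
apply/idP/orP; rewrite !inE.
  by move=> [oy /tle_parent -/(_ wo)[->|yw]]; [left|right; split].
move=> [/eqP ->|[oy yw]]; split => //.
- by split; [exact: origin_tle|apply/eqP; rewrite eq_sym].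
- by apply/tle_parent => //; left.
- by apply/tle_parent => //; right.
Qed.

Hypothesis bJ_gt0 : forall w, w != origin T -> 0 < beta * J w.

Lemma tanh_resistance_gt0 v : 0 < Res v.
Proof.
elim: {v}(depth v) {-2}v (erefl (depth v)) => [|n IH] v dv.
  by rewrite (depth_eq0 dv) tanh_resistance_origin.
have vo : v != origin T by rewrite -depth_gt0 dv.
have /andP[t0 _] := tanh_itv (bJ_gt0 vo).
rewrite tanh_resistance_child// mulr_gt0 ?invr_gt0 ?exprn_gt0//.
by apply: IH; rewrite depth_parentE dv.
Qed.

Lemma tanh_resistance_parent w : w != origin T ->
  Res (parent w) = tanh (beta * J w) ^+ 2 * Res w.
Proof.
move=> wo; have /andP[t0 _] := tanh_itv (bJ_gt0 wo).
by rewrite (tanh_resistance_child wo) mulVKf// expf_neq0// gt_eqF.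
Qed.
End Resistance.

(** * Positive capacity in terms of flows of bounded potential *)

Section Capacity2.
Variables (R : realType) (T : rootedTree) (Res : T -> R).
Hypothesis no_deadend : forall v : T, exists w, w \in children v.
Hypothesis Res_gt0 : forall v, 0 < Res v.
Implicit Types (mu : T -> R) (v w : T).

Lemma flow_ge0 mu w : is_flow mu -> w != origin T -> 0 <= mu w.
Proof. by move=> [mu0 _] /eqP; exact: mu0. Qed.

(** For [p = 2] the exponent is 1, the terms are nonnegative and every vertex lies on a ray; hence
    bounding all series amounts to bounding all their partial sums. *)
Lemma flow_potential_le mu c : is_flow mu ->
  (flow_potential 2 Res mu <= c%:E)%E <->
  forall v, path_sum (fun w => mu w * Res w) v <= c.
Proof.
move=> fmu.
have E y : ray y -> ray_potential 2 Res mu y =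
    (\sum_(0 <= n <oo) (mu (y n.+1) * Res (y n.+1))%:E)%E.
  move=> [_ ye]; apply: eq_eseriesr => n _; congr (_%:E).
  have -> : 2 - 1 = 1 :> R by ring.
  rewrite powRr1// mulr_ge0 ?(ltW (Res_gt0 _))// flow_ge0//.
  by case: (ye n) => /eqP.
have E0 y n : ray y -> (0 <= (mu (y n.+1) * Res (y n.+1))%:E)%E.
  move=> [_ ye]; rewrite lee_fin mulr_ge0 ?(ltW (Res_gt0 _))// flow_ge0//.
  by case: (ye n) => /eqP.
split=> [H v|H].
  have [y [ry <-]] := exists_ray no_deadend v.
  have [_ ->] := ray_path_sum (fun w => mu w * Res w) (depth v) ry.
  rewrite -lee_fin -sumEFin; apply: (le_trans _ H).
  apply: (@le_trans _ _ (ray_potential 2 Res mu y)); last first.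
    by apply: ereal_sup_ubound; exists y.
  by rewrite E//; apply: nneseries_lim_ge => n _ _; exact: E0.
apply: ge_ereal_sup => _ [y ry <-]; rewrite E//.
apply: lime_le; first by apply: is_cvg_nneseries => n _ _; exact: E0.
apply: nearW => n; rewrite sumEFin lee_fin.
by have [_ <-] := ray_path_sum (fun w => mu w * Res w) n ry.
Qed.

Lemma scale_flow mu (a : R) : 0 <= a -> is_flow mu -> is_flow (fun w => a * mu w).
Proof.
move=> a0 [mu0 muE]; split=> [w wo|v w vw lw].
  by rewrite mulr_ge0 ?mu0.
by rewrite (muE v w)// mulr_sumr.
Qed.

Lemma flow_strength_ge0 mu : is_flow mu -> 0 <= flow_strength mu.
Proof.
move=> fmu; rewrite /flow_strength big_seq sumr_ge0// => w /child_neq_origin wo.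
exact: flow_ge0.
Qed.

Lemma path_sumZ (a : R) h v : path_sum (fun w : T => a * h w) v = a * path_sum h v.
Proof. by rewrite /path_sum mulr_sumr. Qed.

(** Replaces the normalisation [V(mu) = 1] by mere boundedness. A flow of positive strength has
    positive potential, and dividing by it gives potential 1. *)
Lemma capacity_neq0P : capacity 2 Res <> 0%E <->
  exists mu C, [/\ is_flow mu, 0 < flow_strength mu &
    forall v, path_sum (fun w => mu w * Res w) v <= C].
Proof.
rewrite /capacity; split.
  case: asboolP => // -[_ [mu0 fmu0 _]].
  move=> H; apply: contrapT => NE; apply: H; apply/eqP; rewrite eq_le; apply/andP; split.
    apply: ge_ereal_sup => _ [mu [fmu V1] <-]; rewrite lee_fin leNgt; apply/negP => s0.
    apply: NE; exists mu, 1; split=> //; apply/(flow_potential_le _ fmu).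
    by rewrite V1.
  apply: (@le_trans _ _ (flow_strength mu0)%:E); last by apply: ereal_sup_ubound; exists mu0.
  by rewrite lee_fin; case: fmu0 => /flow_strength_ge0.
move=> [mu [C [fmu s0 PC]]].
have VC := (flow_potential_le C fmu).2 PC.
(* The empty path at the root already has sum 0, so the potential cannot be negative. *)
have P0 nu : is_flow nu -> flow_potential 2 Res nu <> -oo%E.
  move=> fnu nuoo; have : (flow_potential 2 Res nu <= (-1)%:E)%E by rewrite nuoo leNye.
  by move/(flow_potential_le _ fnu)/(_ (origin T)); rewrite path_sum_origin; lra.
have [w wo mw] : exists2 w, w \in children (origin T) & 0 < mu w.
  apply: contrapT => H; move: s0; rewrite /flow_strength big_seq big1 ?ltxx// => w wo.
  apply/eqP; rewrite eq_le (flow_ge0 fmu (child_neq_origin wo)) andbT leNgt.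
  by apply/negP => mw; apply: H; exists w.
have pw : path_sum (fun w => mu w * Res w) w = mu w * Res w.
  rewrite path_sum_child ?(child_neq_origin wo)//.
  by rewrite (child_parentE wo) path_sum_origin addr0.
case EV : (flow_potential 2 Res mu) VC => [r| |] VC; last 2 first.
- by rewrite leye_eq in VC.
- by have := P0 _ fmu EV.
have Pr : forall v, path_sum (fun w => mu w * Res w) v <= r.
  by apply/(flow_potential_le _ fmu); rewrite EV.
have r0 : 0 < r by apply: lt_le_trans (Pr w); rewrite pw mulr_gt0.
have ri0 : 0 < r^-1 by rewrite invr_gt0.
have fmu' := scale_flow (ltW ri0) fmu.
have PE v : path_sum (fun w => r^-1 * mu w * Res w) v =
    r^-1 * path_sum (fun w => mu w * Res w) v.
  by rewrite -path_sumZ; apply: eq_bigr => i _; rewrite mulrA.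
have V1 : flow_potential 2 Res (fun w => r^-1 * mu w) = 1%E.
  apply/eqP; rewrite eq_le; apply/andP; split.
    by apply/(flow_potential_le _ fmu') => v; rewrite PE ler_pdivrMl// mulr1.
  (* A potential [r' < 1] of the rescaled flow would bound that of [mu] by [r * r'], below its
     actual value [r]. *)
  rewrite leNgt; apply/negP.
  case EV' : (flow_potential 2 Res (fun w => r^-1 * mu w)) => [r'| |].
  - rewrite lte_fin => r'1.
    have : (flow_potential 2 Res mu <= (r * r')%:E)%E.
      apply/(flow_potential_le _ fmu) => v; rewrite -ler_pdivrMl// -PE.
      by move: v; apply/(flow_potential_le _ fmu'); rewrite EV'.
    by rewrite EV lee_fin; nra.
  - by rewrite ltNge leey.
  - by have := P0 _ fmu' EV'.
set A := [set _ | _ in _].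
have Amu : A (flow_strength (fun w => r^-1 * mu w))%:E by exists (fun w => r^-1 * mu w).
case: asboolP => [_|H]; last by case: H; eexists; exact: Amu.
move=> sA; have := ereal_sup_ubound Amu; rewrite sA lee_fin.
rewrite /flow_strength -mulr_sumr -/(flow_strength mu).
by rewrite pmulr_rle0// leNgt s0.
Qed.
End Capacity2.

(** * Flows versus second moments *)

Section SumLimit.
Variables (R : realType) (T : eqType).

Lemma cvg_seq_sum (F : set_system nat) (FF : Filter F) (r : seq T)
    (u : nat -> T -> R) (l : T -> R) :
  (forall w, w \in r -> u n w @[n --> F] --> l w) ->
  \sum_(w <- r) u n w @[n --> F] --> \sum_(w <- r) l w.
Proof.
elim: r => [_|a r IH H].
  rewrite big_nil; under eq_fun do rewrite big_nil; exact: cvg_cst.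
rewrite big_cons; under eq_fun do rewrite big_cons.
apply: cvgD; first by apply: H; rewrite mem_head.
by apply: IH => w wr; apply: H; rewrite in_cons wr orbT.
Qed.

(** A cluster point exists by compactness, and along an ultrafilter a cluster point is a limit. One
    ultrafilter thus serves all vertices at once, with no diagonal extraction. *)
Lemma ultra_cvg_bounded (G : set_system nat) (u : nat -> R) (a b : R) :
  UltraFilter G -> (\forall n \near G, a <= u n <= b) ->
  exists l : R, u n @[n --> G] --> l.
Proof.
move=> GU uab.
have [|l [_ lcl]] := @segment_compact R a b (u n @[n --> G]) _.
  by apply: filterS uab => n; rewrite /= in_itv.
exists l => A Al; have [//|nA] := in_ultra_setVsetC (u @^-1` A) GU.
by have [x [nAx Ax]] := lcl (~` A) A nA Al.
Qed.
End SumLimit.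

Section Flows.
Variables (R : realType) (T : rootedTree) (J : T -> R) (Jmin Jmax beta : R).
Hypothesis no_deadend : forall v : T, exists w, w \in children v.
Hypothesis Jmin_gt0 : 0 < Jmin.
Hypothesis J_bounds : forall v : T, v <> origin T -> Jmin <= J v <= Jmax.
Hypothesis beta_gt0 : 0 < beta.
Hypothesis no_leaf : forall v : T, v <> origin T -> ~ leaf v.
Implicit Types v w : T.

Local Notation Res := (tanh_resistance J beta).
Local Notation o := (origin T).
Local Notation th w := (tanh (beta * J w)).

Lemma bJ_gt0 w : w != o -> 0 < beta * J w.
Proof.
by move=> /eqP/J_bounds/andP[h _]; rewrite mulr_gt0// (lt_le_trans Jmin_gt0).
Qed.

Local Notation field2 N := (field2 J beta N).
Local Notation message2 N := (message2 J beta N).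

(* small enough to satisfy the hypothesis of [message2_le] on every edge at once *)
Definition sat_const : R :=
  tanh (beta * Jmin) ^+ 2 * (1 - tanh (beta * Jmax) ^+ 2) /
  (8 + 4 * (beta * Jmax) ^+ 2).

Lemma Jmax_gt0 : 0 < Jmax.
Proof.
have [w /child_neq_origin/eqP/J_bounds/andP[h1 h2]] := no_deadend o.
exact: lt_le_trans (le_trans h1 h2).
Qed.

Lemma sat_const_gt0 : 0 < sat_const.
Proof.
have /andP[t0 _] := tanh_itv (mulr_gt0 beta_gt0 Jmin_gt0).
have /andP[t0' t1] := tanh_itv (mulr_gt0 beta_gt0 Jmax_gt0).
rewrite divr_gt0//; first by rewrite mulr_gt0 ?exprn_gt0// subr_gt0 expr_lt1// ltW.
by rewrite ltr_pwDl// mulr_ge0// sqr_ge0.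
Qed.

Lemma sat_constP w : w != o ->
  sat_const * (8 * th w ^+ 2 + 4 * (beta * J w) ^+ 2 * (1 - th w ^+ 2)) <=
  th w ^+ 2 * (1 - th w ^+ 2).
Proof.
move=> wo; have b0 := bJ_gt0 wo; have /andP[t0 t1] := tanh_itv b0.
have /eqP/J_bounds/andP[J1 J2] := wo.
have b1 : beta * Jmin <= beta * J w by rewrite ler_pM2l.
have b2 : beta * J w <= beta * Jmax by rewrite ler_pM2l.
have /andP[m0 _] := tanh_itv (mulr_gt0 beta_gt0 Jmin_gt0).
have /andP[_ M1] := tanh_itv (mulr_gt0 beta_gt0 Jmax_gt0).
have m1 := tanh_le b1; have m2 := tanh_le b2.
set t := th w in t0 t1 m1 m2 *; set p := tanh _ in m0 m1; set q := tanh _ in M1 m2.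
have D0 : 0 < 8 + 4 * (beta * Jmax) ^+ 2.
  by rewrite ltr_pwDl// mulr_ge0// sqr_ge0.
have t2 : 0 <= t ^+ 2 <= 1 by rewrite sqr_ge0 expr_le1// ltW.
apply: (@le_trans _ _ (sat_const * (8 + 4 * (beta * Jmax) ^+ 2))).
  rewrite ler_pM2l ?sat_const_gt0//; case/andP: t2 => t20 t21; apply: lerD.
    by rewrite ler_piMr.
  apply: (@le_trans _ _ (4 * (beta * J w) ^+ 2)).
    by apply: ler_piMr; rewrite ?gerBl// mulr_ge0// sqr_ge0.
  by rewrite ler_pM2l// ler_sqr ?nnegrE ?(le_trans (ltW b0))// ltW.
rewrite /sat_const divfK ?gt_eqF// -/p -/q; apply: ler_pM.
- exact: sqr_ge0.
- by rewrite subr_ge0 expr_le1// ?(ltW M1)// (le_trans (ltW t0)).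
- by rewrite ler_sqr ?nnegrE// ltW.
- rewrite lerB// ler_sqr ?nnegrE//; first exact: ltW.
  by rewrite (le_trans (ltW t0)).
Qed.

(** With [m = mu w * Res w] and [s] the second moment at [w], the hypothesis rearranges to m <= a s
    / (1 + 3 s / 4), the saturated form bounded by [message2_ge]; the factor [tanh ^+ 2] there is
    the ratio of the resistances at [v] and [w]. *)
Lemma flow_step N n v (mu : T -> R) (a : R) : (depth v + n.+1 < N)%N ->
  0 <= a -> (forall w, w \in children v -> 0 <= mu w /\
     mu w * Res w <= field2 N n w * (a - 3 / 4 * (mu w * Res w))) ->
  (\sum_(w <- children v) mu w) * Res v <= field2 N n.+1 v * a.
Proof.
move=> vN a0 H; have [-> _] := field2_kurtosis bJ_gt0 vN.
rewrite !mulr_suml big_seq [leRHS]big_seq; apply: ler_sum => w wv.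
have wo := child_neq_origin wv; have [mu0 mus] := H w wv.
have wN : (depth w + n < N)%N by rewrite (depth_child wv) addSnnS.
have s0 := field2_ge0 J beta N n w.
have lb := message2_ge bJ_gt0 wo wN.
have R0 := tanh_resistance_gt0 bJ_gt0 w.
have m0 : 0 <= mu w * Res w by rewrite mulr_ge0// ltW.
set s := field2 N n w in s0 lb mus; set m := mu w * Res w in m0 mus.
have d0 : 0 < 1 + s * 3 / 4 by rewrite ltr_pwDl// divr_ge0// mulr_ge0.
apply: le_trans (ler_wpM2r a0 lb).
rewrite -(child_parentE wv) (tanh_resistance_parent bJ_gt0 wo) mulrCA -/m.
rewrite -[leRHS](mulrA (th w ^+ 2)) ler_wpM2l ?sqr_ge0// mulrAC ler_pdivlMr//.
lra.
Qed.

Lemma flow_children (mu : T -> R) v : is_flow mu -> v != o ->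
  mu v = \sum_(w <- children v) mu w.
Proof.
move=> [_ muE] vo; apply: (muE (parent v)); last exact/no_leaf/eqP.
by apply/childrenP; exact: child_parent.
Qed.

Lemma field2_0_ge N v : (depth v < N)%N ->
  4 * (beta * Jmin) ^+ 2 <= field2 N 0 v.
Proof.
move=> vN; have [|-> _] := @field2_kurtosis R T J beta N bJ_gt0 0 v; first by rewrite addn0.
have [w wv] := no_deadend v; rewrite (big_rem w)//=.
apply: (@le_trans _ _ (message2 N 0 w)); last first.
  by rewrite lerDl sumr_ge0// => *; exact: message2_ge0.
rewrite message2_0 ler_pM2l// ler_sqr ?nnegrE.
- have /eqP/J_bounds/andP[J1 _] := child_neq_origin wv.
  by rewrite ler_pM2l.
- by rewrite mulr_ge0// ltW.
- by rewrite ltW// bJ_gt0// (child_neq_origin wv).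
Qed.

Lemma path_sum_ge0 (h : T -> R) v : (forall w, w != o -> 0 <= h w) ->
  0 <= path_sum h v.
Proof.
move=> h0; rewrite /path_sum big_nat sumr_ge0// => i /andP[_ iv]; apply: h0.
by rewrite -depth_gt0 depth_iter_parent subn_gt0.
Qed.

(** * A flow of bounded potential bounds the second moment at the root from below *)

Section LowerBound.
Variables (mu : T -> R) (C : R).
Hypotheses (fmu : is_flow mu)
  (muC : forall v, path_sum (fun w => mu w * Res w) v <= C).

Local Notation P := (path_sum (fun w => mu w * Res w)).
(** A lower bound for the second moment one level above the boundary. The summand [C / delta] of
    [slack] settles that base case; the rest of [slack] is 3/4 of the potential not yet used. *)
Local Notation delta := (4 * (beta * Jmin) ^+ 2).
Local Notation slack v := (3 / 4 * C + C / delta - 3 / 4 * P v).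

Lemma potential_bound_ge0 : 0 <= C.
Proof. by rewrite -(path_sum_origin (fun w => mu w * Res w)). Qed.

Lemma delta_gt0 : 0 < delta.
Proof. by rewrite mulr_gt0// exprn_gt0// mulr_gt0. Qed.

Lemma slack_ge v : C / delta <= slack v.
Proof. by have := muC v; lra. Qed.

Lemma slack_ge0 v : 0 <= slack v.
Proof.
by apply: le_trans (slack_ge v); rewrite divr_ge0 ?potential_bound_ge0// ltW// delta_gt0.
Qed.

Lemma flow_resistance_ge0 w : w != o -> 0 <= mu w * Res w.
Proof.
by move=> wo; rewrite mulr_ge0 ?(flow_ge0 fmu)// ltW// tanh_resistance_gt0//; exact: bJ_gt0.
Qed.

(* The slack at a child w is the slack at its parent minus [3/4 * mu w * Res w],
   which is exactly what the saturation [s / (1 + 3/4 * s)] costs. *)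
Lemma flow_field2 N n v : v != o -> (depth v + n.+1 = N)%N ->
  mu v * Res v <= field2 N n v * slack v.
Proof.
elim: n v => [|n IH] v vo vN.
  have s0 : delta <= field2 N 0 v by apply: field2_0_ge; rewrite -vN addn1.
  have mC : mu v * Res v <= C.
    apply: le_trans (muC v); rewrite path_sum_child// lerDl.
    exact: path_sum_ge0 flow_resistance_ge0.
  apply: (le_trans mC); apply: (@le_trans _ _ (delta * (C / delta))).
    by rewrite mulrCA divff ?mulr1// gt_eqF// delta_gt0.
  apply: ler_pM => //; first exact: ltW delta_gt0.
    by rewrite divr_ge0 ?potential_bound_ge0// ltW// delta_gt0.
  exact: slack_ge.
rewrite [in mu v](flow_children fmu vo); apply: flow_step.
- by rewrite -vN ltn_add2l.
- exact: slack_ge0.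
- move=> w wv; have wo := child_neq_origin wv; split; first exact: flow_ge0.
  have := IH w wo; rewrite (depth_child wv) addSnnS => /(_ vN).
  rewrite (path_sum_child _ wo) (child_parentE wv).
  by congr (_ <= _ * _); ring.
Qed.

Lemma flow_strength_field2 n :
  flow_strength mu <= field2 n.+2 n.+1 o * (3 / 4 * C + C / delta).
Proof.
have := @flow_step n.+2 n o mu (slack o).
rewrite depth_origin path_sum_origin mulr0 subr0 => H.
apply: (@le_trans _ _ (flow_strength mu * Res o)).
  by rewrite tanh_resistance_origin mulr1.
apply: H => //; first by have := slack_ge0 o; rewrite path_sum_origin mulr0 subr0.
move=> w wv; have wo := child_neq_origin wv; split; first exact: flow_ge0.
have := @flow_field2 n.+2 n w wo; rewrite (depth_child wv) depth_origin => /(_ erefl).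
rewrite (path_sum_child _ wo) (child_parentE wv) path_sum_origin.
by congr (_ <= _ * _); ring.
Qed.
End LowerBound.

(** * The flow that splits in proportion to second moments *)

Section Splitting.
Variable N : nat.

(** The recursion is on [k], meant to be the depth of [w]. A vertex at depth [k.+1] has [N - k.+1]
    levels below it, and the field at its parent sums messages with that same index. *)
Fixpoint split_down k w : R :=
  if k is k.+1 then split_down k (parent w) *
    (message2 N (N - k.+1) w / field2 N (N - k.+1) (parent w))
  else 1.

Definition split_flow w : R := split_down (depth w) w.

Lemma split_flow_origin : split_flow o = 1.
Proof. by rewrite /split_flow depth_origin. Qed.

Lemma split_flow_child v w : w \in children v -> split_flow w =
  split_flow v * (message2 N (N - (depth v).+1) w / field2 N (N - (depth v).+1) v).
Proof.
by move=> wv; rewrite /split_flow (depth_child wv) /= (child_parentE wv).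
Qed.

Lemma split_flow_ge0 w : 0 <= split_flow w.
Proof.
suff H k u : 0 <= split_down k u by exact: H.
elim: k u => [|k IH] u //=; rewrite mulr_ge0// divr_ge0//.
  exact: message2_ge0.
exact: field2_ge0.
Qed.

Lemma field2_split v : (depth v < N)%N ->
  field2 N (N - (depth v).+1) v =
    \sum_(w <- children v) message2 N (N - (depth v).+1) w /\
  0 < field2 N (N - (depth v).+1) v.
Proof.
move=> vN; have h : (depth v + (N - (depth v).+1) < N)%N.
  by rewrite -addSn subnKC.
split; first by have [] := field2_kurtosis bJ_gt0 h.
exact: field2_gt0 bJ_gt0 _ _ no_deadend h.
Qed.

Lemma split_flow_sum v : (depth v < N)%N ->
  \sum_(w <- children v) split_flow w = split_flow v.
Proof.
move=> vN; have [E s0] := field2_split vN.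
rewrite big_seq (eq_bigr _ (fun w wv => split_flow_child wv)) -big_seq.
by rewrite -mulr_sumr -mulr_suml -E divff ?mulr1// gt_eqF.
Qed.

Lemma split_flow_le1 v : (depth v <= N)%N -> split_flow v <= 1.
Proof.
elim: {v}(depth v) {-2}v (erefl (depth v)) => [|n IH] v dv vN.
  by rewrite (depth_eq0 dv) split_flow_origin.
have vo : v != o by rewrite -depth_gt0 dv.
have pN : (depth (parent v) < N)%N by rewrite depth_parentE; move: vN; rewrite dv.
apply: (@le_trans _ _ (split_flow (parent v))); last first.
  by apply: IH; rewrite ?(ltnW pN)// depth_parentE dv.
rewrite -(split_flow_sum pN) (big_rem _ (child_parent vo))/= lerDl.
by rewrite sumr_ge0// => w _; exact: split_flow_ge0.
Qed.

(* With A_v the first summand, saturation gives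
   [A_w + sat_const * split_flow w * Res w <= A_v] for every child w of v, and
   this telescopes along the path. *)
Lemma split_flow_potential v : (depth v < N)%N ->
  split_flow v * Res v / field2 N (N - (depth v).+1) v +
    sat_const * path_sum (fun w => split_flow w * Res w) v <=
  (field2 N N.-1 o)^-1.
Proof.
elim: {v}(depth v) {-2}v (erefl (depth v)) => [|n IH] v dv vN.
  rewrite (depth_eq0 dv) split_flow_origin tanh_resistance_origin depth_origin.
  by rewrite path_sum_origin mulr0 addr0 !mul1r subn1.
have vo : v != o by rewrite -depth_gt0 dv.
have pN : (depth (parent v) < N)%N by rewrite depth_parentE; move: vN; rewrite dv => /ltnW.
apply: le_trans (IH (parent v) _ pN); last by rewrite depth_parentE dv.
rewrite path_sum_child// mulrDr addrA lerD2r.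
have [_ s0] := field2_split vN; have [_ t0] := field2_split pN.
have vN' : (N - (depth (parent v)).+1 = (N - (depth v).+1).+1)%N.
  by rewrite -(depth_parent vo) subnSK.
have ub k := @message2_le R T J beta N bJ_gt0 k v sat_const vo (ltW sat_const_gt0) (sat_constP vo).
have R0 := tanh_resistance_gt0 bJ_gt0 v.
have m0 := split_flow_ge0 (parent v).
have /andP[th0 _] := tanh_itv (bJ_gt0 vo).
rewrite (split_flow_child (child_parent vo)) vN' in t0 *.
rewrite (tanh_resistance_parent bJ_gt0 vo).
move: (ub (N - (depth v).+1)%N) => {}ub.
set s := field2 N _ v in s0 ub *; set t := field2 N _ (parent v) in t0 *.
set e := message2 N _ v in ub *; set m := split_flow (parent v) in m0 *.
have c0 := sat_const_gt0; set c := sat_const in c0 ub *.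
have d0 : 0 < 1 + c * s by rewrite ltr_pwDl// mulr_ge0// ltW.
set p := Res v in R0 *; set h := th v in th0 ub *.
(* Factoring both sides by [m * p / t] leaves exactly [message2_le]. *)
rewrite (_ : _ + _ = (m * p / t) * (e * (1 + c * s) / s)); last first.
  by field; rewrite !gt_eqF.
rewrite [leRHS](_ : _ = (m * p / t) * h ^+ 2); last by field; rewrite gt_eqF.
apply: ler_wpM2l.
  by rewrite divr_ge0 ?(ltW t0)// mulr_ge0// ltW.
rewrite ler_pdivrMr// -ler_pdivlMr// -mulrA; exact: ub.
Qed.
End Splitting.

(** Split flows on growing truncations take values in [0, 1], so they converge along an ultrafilter.
    Conservation and the potential bound involve finitely many vertices each and survive in the
    limit. *)
Lemma capacity_neq0_of_field2 (eps : R) : 0 < eps ->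
  (forall M, exists N, (M <= N)%N /\ eps <= field2 N.+1 N o) ->
  capacity 2 Res <> 0%E.
Proof.
move=> eps0 freq.
(* Restricting to the good [N] before refining to an ultrafilter keeps the lower bound [eps] valid
   along it. *)
pose G0 := within [set N | eps <= field2 N.+1 N o] (\oo : set_system nat).
have G0P : ProperFilter G0.
  apply: Build_ProperFilter_ex => A [M _ MA].
  by have [N [MN epsN]] := freq M; exists N; apply: MA.
have [G [GU GG]] := ultraFilterLemma G0P.
have GP : ProperFilter G := @ultra_proper _ _ GU.
have Glarge M : \forall N \near G, (M <= N)%N /\ eps <= field2 N.+1 N o.
  by apply: GG; exists M => // N /= MN epsN.
have lim_ex w : exists l : R, split_flow N.+1 w @[N --> G] --> l.
  apply: (@ultra_cvg_bounded R G _ 0 1 GU); apply: filterS (Glarge (depth w)) => N [wN _].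
  by rewrite split_flow_ge0 split_flow_le1// ltnW.
have [mu muP] := choice lim_ex.
have mu0 w : 0 <= mu w.
  by apply: (@cvgr_to_ge _ G GP _ _ _ _ (muP w)); apply: nearW => N; exact: split_flow_ge0.
have mu_sum v : mu v = \sum_(w <- children v) mu w.
  have := cvg_seq_sum _ (fun w (_ : w \in children v) => muP w).
  have E : \forall N \near G, \sum_(w <- children v) split_flow N.+1 w = split_flow N.+1 v.
    by apply: filterS (Glarge (depth v)) => N [vN _]; rewrite split_flow_sum// ltnS.
  move=> /(_ _) H; apply: (cvg_unique (@norm_hausdorff _ _) (muP v)).
  by apply: cvg_trans H; apply: near_eq_cvg.
have mu_o : mu o = 1.
  apply: (cvg_unique (@norm_hausdorff _ _) (muP o)).
  have E : (fun N => split_flow N.+1 o) = fun=> 1.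
    by apply/funext => N; rewrite split_flow_origin.
  by rewrite /= E; exact: cvg_cst.
apply/(capacity_neq0P no_deadend); first exact: tanh_resistance_gt0 bJ_gt0.
exists mu, (sat_const * eps)^-1; split.
- by split=> [w _|v w _ _]; [exact: mu0|exact: mu_sum].
- by rewrite /flow_strength -mu_sum mu_o.
move=> v; have : path_sum (fun w => split_flow N.+1 w * Res w) v @[N --> G] -->
    path_sum (fun w => mu w * Res w) v.
  apply: (@cvg_seq_sum R nat G _ (index_iota 0 (depth v))
    (fun N i => split_flow N.+1 (iter i parent v) * Res (iter i parent v))
    (fun i => mu (iter i parent v) * Res (iter i parent v))) => i _.
  by apply: cvgMl; exact: muP.
move/(@cvgr_to_le _ G GP); apply; apply: filterS (Glarge (depth v)) => N [vN epsN].
have := @split_flow_potential N.+1 v vN.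
(* The first summand in [split_flow_potential] is nonnegative and is dropped. *)
set q := _ / _; have q0 : 0 <= q.
  apply: mulr_ge0; last by rewrite invr_ge0; exact: field2_ge0.
  apply: mulr_ge0; first exact: split_flow_ge0.
  by rewrite ltW// tanh_resistance_gt0//; exact: bJ_gt0.
move=> h; rewrite invfM ler_pdivlMl ?sat_const_gt0//.
apply: (@le_trans _ _ (field2 N.+1 N o)^-1); first by rewrite /= in h; lra.
by rewrite lef_pV2// posrE ?(lt_le_trans eps0).
Qed.
End Flows.

(** * Convergence in law *)

Section Logistic.
Variable R : realType.
Implicit Type x : R.

Definition logistic x : R := expR x / (expR x + 1).

Lemma logistic_center x :
  2 * logistic x - 1 = (expR x - 1) / (expR x + 1).
Proof. by rewrite /logistic; field; rewrite gt_eqF// addr_gt0// expR_gt0. Qed.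

Lemma logistic_dist_sqr x : (logistic x - 1 / 2) ^+ 2 <= x ^+ 2.
Proof.
have -> : logistic x - 1 / 2 = (expR x - 1) / (expR x + 1) / 2.
  by rewrite -logistic_center; field.
rewrite -[leRHS]real_normK ?num_real// -[leLHS]real_normK ?num_real//.
rewrite ler_sqr ?nnegrE//.
have ex := expR_gt0 x; have e1 : 0 < expR x + 1 by rewrite addr_gt0.
rewrite !normrM !normfV (gtr0_norm e1) [X in _ / X]ger0_norm//.
rewrite ler_pdivrMr// ler_pdivrMr//.
have h1 := expR_ge1Dx x; have h2 := expR_ge1Dx (- x); rewrite expRN in h2.
have h3 : (1 - x) * expR x <= 1.
  have := ler_wpM2r (ltW ex) h2; rewrite mulVf ?gt_eqF//; lra.
rewrite ler_norml; have [x0|x0] := leP 0 x.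
  by rewrite (ger0_norm x0); apply/andP; split; nra.
by rewrite (ltr0_norm x0); apply/andP; split; nra.
Qed.

Lemma logistic_sqr_le1 x : (2 * logistic x - 1) ^+ 2 <= 1.
Proof.
have ex := expR_gt0 x; have e1 : 0 < expR x + 1 by rewrite addr_gt0.
rewrite logistic_center exprMn exprVn ler_pdivrMr ?exprn_gt0// mul1r; nra.
Qed.
End Logistic.

Section Main.
Variables (R : realType) (T : rootedTree).
Hypothesis T_infinite : infinite_set [set: T].
Hypothesis T_noleaf : forall v : T, v <> origin T -> ~ leaf v.
Variables (J : T -> R) (Jmin Jmax beta : R).
Hypothesis Jmin_gt0 : 0 < Jmin.
Hypothesis J_bounds : forall v : T, v <> origin T -> Jmin <= J v <= Jmax.
Hypothesis beta_gt0 : 0 < beta.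

Local Notation o := (origin T).
Local Notation Res := (tanh_resistance J beta).
Local Notation root2 n := (field2 J beta n.+1 n o).

Let hasc := no_deadend T_infinite T_noleaf.
Let bpos := bJ_gt0 Jmin_gt0 J_bounds beta_gt0.

Lemma sg_expectation_logistic n (f : R -> R) :
  \sum_(eta : config T n.+1) sg_prob J beta eta * f (sg_origin_cond J beta eta) =
  avg (fun eta : config T n.+1 => f (logistic (field_var J beta n o eta))).
Proof. by rewrite (@sg_expectationE R T J beta n.+1 n f erefl). Qed.

Lemma root2_cvg0 : capacity 2 Res = 0%E -> root2 n @[n --> \oo] --> 0.
Proof.
move=> cap0; apply/cvgrPdist_lt => eps eps0.
apply: contrapT => H.
apply: (capacity_neq0_of_field2 hasc Jmin_gt0 J_bounds beta_gt0 eps0 _ cap0) => M.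
apply: contrapT => H'; apply: H; exists M => // n /= Mn.
rewrite sub0r normrN ger0_norm; last exact: field2_ge0.
by rewrite ltNge; apply/negP => en; apply: H'; exists n.
Qed.

(** A Chebyshev argument: near 1/2 the test function varies little, and away from it its oscillation
    is absorbed by a multiple of [x ^+ 2], whose mean is [root2 n]. *)
Lemma cvg_in_law_of_root2 : root2 n @[n --> \oo] --> 0 ->
  cvg_in_law_cst (fun N => @sg_prob R T J beta N)
                 (fun N => @sg_origin_cond R T J beta N) (1 / 2).
Proof.
move=> s0 f cf [M [_ fM]].
rewrite -cvg_shiftS /=.
under eq_fun do rewrite sg_expectation_logistic.
have {}fM x : `|f x| <= `|M| + 1.
  by apply: (fM (`|M| + 1)) => //; rewrite (le_lt_trans (ler_norm M))// ltrDl.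
set K := `|M| + 1 in fM.
have K0 : 0 < K by rewrite /K ltr_wpDl.
apply/cvgrPdist_le => eps eps0.
have : \forall x \near (1 / 2 : R), `|f (1 / 2) - f x| < eps / 2.
  by have /cvgrPdist_lt := cf (1 / 2); apply; rewrite divr_gt0.
move=> /nbhs_ballP[d /= d0 fd].
(* The threshold for the second moment at which the quadratic term of [b] below contributes
   [eps / 2]. *)
have c0 : 0 < eps / 2 * d ^+ 2 / (2 * K).
  by rewrite divr_gt0 ?mulr_gt0 ?exprn_gt0 ?divr_gt0.
move/cvgrPdist_lt: s0 => /(_ _ c0); apply: filterS => n.
rewrite sub0r normrN ger0_norm; last exact: field2_ge0.
move=> sn.
have b x : `|f (1 / 2) - f (logistic x)| <= eps / 2 + 2 * K / d ^+ 2 * x ^+ 2.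
  have [h|h] := ltP `|1 / 2 - logistic x| d.
    apply: (@le_trans _ _ (eps / 2)); first exact/ltW/fd.
    by rewrite lerDl mulr_ge0 ?sqr_ge0// divr_ge0 ?mulr_ge0 ?sqr_ge0// ltW.
  apply: (@le_trans _ _ (K + K)); first by rewrite (le_trans (ler_normB _ _))// lerD.
  have dx : d ^+ 2 <= x ^+ 2.
    apply: le_trans (logistic_dist_sqr x).
    rewrite -[leRHS]real_normK ?num_real// ler_sqr ?nnegrE ?(ltW d0)//.
    by rewrite distrC.
  apply: (@le_trans _ _ (2 * K / d ^+ 2 * d ^+ 2)).
    by rewrite divfK ?gt_eqF ?exprn_gt0//; lra.
  apply: ler_wpDl; first by rewrite ltW// divr_gt0.
  by rewrite ler_wpM2l// divr_ge0 ?sqr_ge0// mulr_ge0// ltW.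
have cs := card_spins_gt0 (trunc T n.+1).
set X := field_var J beta n o.
have -> : f (1 / 2) - avg (fun eta : config T n.+1 => f (logistic (X eta))) =
    avg (fun eta : config T n.+1 => f (1 / 2) - f (logistic (X eta))).
  rewrite avgD avg_cst//; congr (_ + _).
  by rewrite -[RHS]mul1r -[1]opprK mulNr -avgZ; under [in RHS]eq_avg do rewrite mulrNN mul1r.
rewrite (@le_trans _ _ (avg (fun eta : config T n.+1 => `|f (1 / 2) - f (logistic (X eta))|)))//.
  rewrite /avg normrM ger0_norm ?invr_ge0// ler_wpM2l ?invr_ge0//.
  exact: ler_norm_sum.
apply: (@le_trans _ _ (avg (fun eta : config T n.+1 => eps / 2 + 2 * K / d ^+ 2 * X eta ^+ 2))).
  by apply: avg_le => // eta; exact: b.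
rewrite avgD avg_cst// avgZ -/(moment 2 X) -/(field2 J beta n.+1 n o).
rewrite -lerBrDl (_ : eps - eps / 2 = eps / 2); last by field.
rewrite -ler_pdivlMl ?divr_gt0 ?mulr_gt0 ?exprn_gt0//.
apply: (le_trans (ltW sn)); rewrite le_eqVlt; apply/orP; left; apply/eqP; field.
by rewrite !gt_eqF.
Qed.

Lemma root2_lower : capacity 2 Res <> 0%E ->
  exists2 eps : R, 0 < eps & forall n, eps <= root2 n.+1.
Proof.
move=> /(capacity_neq0P hasc (tanh_resistance_gt0 bpos))[mu [C [fmu s0 PC]]].
have C0 := potential_bound_ge0 PC.
pose D := 3 / 4 * C + C / (4 * (beta * Jmin) ^+ 2).
have D0 : 0 <= D.
  by apply: addr_ge0; rewrite mulr_ge0// invr_ge0 mulr_ge0// sqr_ge0.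
have lb n : flow_strength mu <= root2 n.+1 * D.
  exact: (flow_strength_field2 hasc Jmin_gt0 J_bounds beta_gt0 T_noleaf fmu PC n).
have Dp : 0 < D.
  by rewrite lt0r D0 andbT; apply: contraTneq (lb 0%N) => ->; rewrite mulr0 -ltNge.
exists (flow_strength mu / D); first by rewrite divr_gt0.
by move=> n; rewrite ler_pdivrMr.
Qed.

Lemma not_cvg_in_law (eps : R) : 0 < eps -> (forall n, eps <= root2 n.+1) ->
  ~ cvg_in_law_cst (fun N => @sg_prob R T J beta N)
                   (fun N => @sg_origin_cond R T J beta N) (1 / 2).
Proof.
(* At [logistic x] this test function equals tanh(x/2)^2; the minimum with 1 only makes it bounded
   on the whole line. *)
move=> eps0 lb; pose f (p : R) : R := Num.min 1 ((2 * p - 1) ^+ 2).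
move=> /(_ f) H; have f0 : f (1 / 2) = 0.
  by rewrite /f (_ : 2 * (1 / 2) - 1 = 0) ?expr0n ?min_r//; field.
have cf : continuous f.
  move=> p; apply: (@continuous_min R R (cst 1) (fun p : R => (2 * p - 1) ^+ 2)).
    exact: cvg_cst.
  have c : 2 * q - 1 @[q --> p] --> 2 * p - 1.
    by apply: cvgB; [apply: cvgMr; exact: cvg_id|exact: cvg_cst].
  exact: (cvgM c c).
have bf : bounded_fun f.
  exists 1; split; first exact: num_real.
  move=> M M1 p _ /=; rewrite ger0_norm.
    by rewrite (le_trans _ (ltW M1))// ge_min lexx.
  by rewrite le_min ler01 sqr_ge0.
have {H} := H cf bf; rewrite f0.
(* The bound that [sqr_tanh_half_ge] and [avg_saturation_ge] with [c = 4^-1] give when the second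
   moment equals [eps]; it increases with that moment. *)
set d := 4^-1 * (eps / (1 + 3 * 4^-1 * eps)).
have d0 : 0 < d by rewrite mulr_gt0// divr_gt0// addr_gt0// mulr_gt0.
move/cvgrPdist_lt => /(_ _ d0)[n _ /(_ n.+2 (ltnW (leqnSn n.+1)))].
rewrite /= (sg_expectation_logistic n.+1 f).
apply/negP; rewrite -leNgt sub0r normrN.
have cs := card_spins_gt0 (trunc T n.+2).
set X := field_var J beta n.+1 o.
have [|_ k4] := @field2_kurtosis R T J beta n.+2 bpos n.+1 o.
  by rewrite depth_origin.
apply: le_trans (ler_norm _).
apply: (@le_trans _ _ (4^-1 *
    avg (fun eta : config T n.+2 => X eta ^+ 2 / (1 + 4^-1 * X eta ^+ 2)))).
  rewrite ler_pM2l//; apply: le_trans (avg_saturation_ge cs _ k4); last by rewrite invr_ge0.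
  have := lb n; rewrite /field2 -/X; set s := moment 2 X => es; clearbody s.
  have s0 : 0 < s by apply: lt_le_trans es.
  rewrite ler_pdivrMr ?addr_gt0 ?mulr_gt0// mulrAC ler_pdivlMr ?addr_gt0 ?mulr_gt0//.
  nra.
rewrite -avgZ; apply: avg_le => // eta; set x := X eta.
rewrite /f min_r ?logistic_sqr_le1// logistic_center.
apply: le_trans (sqr_tanh_half_ge x); rewrite le_eqVlt; apply/orP; left; apply/eqP.
have := sqr_ge0 x; move: (x ^+ 2) => z z0; field.
by rewrite gt_eqF// ltr_pwDl.
Qed.
End Main.

Theorem theorem2p5 (R : realType) (T : rootedTree)
    (T_infinite : infinite_set [set: T])
    (T_noleaf : forall v : T, v <> origin T -> ~ leaf v)
    (J : T -> R) (Jmin Jmax beta : R)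
    (Jmin_gt0 : 0 < Jmin)
    (J_bounds : forall v : T, v <> origin T -> Jmin <= J v <= Jmax)
    (beta_gt0 : 0 < beta) :
  cvg_in_law_cst (fun N => @sg_prob R T J beta N)
                 (fun N => @sg_origin_cond R T J beta N) (1 / 2)
  <-> capacity 2 (tanh_resistance J beta) = 0%E.
Proof.
split=> [law|cap0]; last first.
  apply: cvg_in_law_of_root2.
  exact: (@root2_cvg0 R T T_infinite T_noleaf J _ _ beta Jmin_gt0 J_bounds beta_gt0 cap0).
apply: contrapT => cap.
have [eps eps0 lb] := root2_lower T_infinite T_noleaf Jmin_gt0 J_bounds beta_gt0 cap.
exact: (not_cvg_in_law Jmin_gt0 J_bounds beta_gt0 eps0 lb law).
Qed.
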